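(* There is a normal vertex-to-vertex tiling $\mathcal{T}$ of the plane $\mathbb{R}^2$ by pairwise non-congruent convex quadrangles of unit area. Moreover, $\mathcal{T}$ consists of squares that are dissected into four distinct quadrangles of equal area; that is, there is a tiling of $\mathbb{R}^2$ by squares such that each of these squares is the union of four pairwise non-congruent quadrangles of $\mathcal{T}$, and every tile of $\mathcal{T}$ arises in this way.
   Context: A tiling of $\mathbb{R}^2$ is a collection $\{T_1, T_2, \ldots\}$ of compact sets $T_i \subset \mathbb{R}^2$ (the tiles) such that the interiors of distinct tiles are disjoint and the union of all tiles equals $\mathbb{R}^2$. A tiling by polygons is vertex-to-vertex if the intersection of any two distinct tiles is either an entire edge of both tiles, or a point, or empty. A tiling is normal if there are real numbers $R > r > 0$ such that (1) each tile contains some ball of radius $r$, and (2) each tile is contained in some ball of radius $R$. A quadrangle is a polygon with four vertices. *)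

(* Defs.v *)
(* MathComp-Analysis *)
From HB Require Import structures.
From mathcomp Require Import all_boot all_order all_algebra.
From mathcomp Require Import all_classical all_reals all_analysis.

Set Implicit Arguments.
Unset Strict Implicit.
Unset Printing Implicit Defensive.

Import Order.TTheory GRing.Theory Num.Theory.
Import numFieldNormedType.Exports.

Local Open Scope classical_set_scope.
Local Open Scope ring_scope.

Section Plane.
Context {R : realType}.

(* R^2 is R * R: its topology is the usual one, but the library norm and [ball]
   on it are those of the maximum norm, whence the explicit Euclidean notions. *)
Implicit Types (a b c x y : R * R) (A B E S T U : set (R * R)).
Implicit Types TT SS : set (set (R * R)).

Definition dot x y : R := x.1 * y.1 + x.2 * y.2.

Definition edist x y : R := Num.sqrt (dot (x - y) (x - y)).

Definition eball c (r : R) : set (R * R) := [set x | edist c x <= r].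

(* Direct and indirect isometries are both allowed. *)
Definition congruent A B : Prop :=
  exists f : R * R -> R * R,
    (forall x y, edist (f x) (f y) = edist x y) /\ f @` A = B.

Definition area A : \bar R := (@lebesgue_measure R \x @lebesgue_measure R)%E A.

Definition segment a b : set (R * R) :=
  [set x | exists2 t : R, 0 <= t <= 1 & x = (1 - t) *: a + t *: b].

Definition conv_hull n (p : 'I_n -> R * R) : set (R * R) :=
  [set x | exists w : 'I_n -> R,
     [/\ forall i, 0 <= w i, \sum_i w i = 1 & x = \sum_i w i *: p i]].

(* Twice the signed area of the triangle a b c: positive exactly when c lies
   strictly to the left of the line directed from a to b. *)
Definition orient a b c : R :=
  (b.1 - a.1) * (c.2 - a.2) - (b.2 - a.2) * (c.1 - a.1).

(* p lists counterclockwise the vertices of a convex n-gon ([ordS] is the cyclic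
   successor): each side leaves all the other vertices strictly on its left, so
   that no angle is straight and [conv_hull p] determines p up to rotation. *)
Definition convex_vertices n (p : 'I_n -> R * R) : Prop :=
  (2 < n)%N /\
  forall i j, j != i -> j != ordS i -> 0 < orient (p i) (p (ordS i)) (p j).

Definition convex_polygon n T : Prop :=
  exists p : 'I_n -> R * R, convex_vertices p /\ T = conv_hull p.

Definition convex_quadrangle T : Prop := convex_polygon 4 T.

Definition square T : Prop :=
  exists p : 'I_4 -> R * R,
    [/\ convex_vertices p,
        T = conv_hull p,
        forall i j, edist (p i) (p (ordS i)) = edist (p j) (p (ordS j)) &
        forall i, dot (p (ordS i) - p i) (p (ordS (ordS i)) - p (ordS i)) = 0].

Definition is_edge E T : Prop :=
  exists n (p : 'I_n -> R * R),
    [/\ convex_vertices p, T = conv_hull p &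
        exists i, E = segment (p i) (p (ordS i))].

Definition tiling TT : Prop :=
  [/\ countable TT,
      forall T, TT T -> compact T,
      forall T U, TT T -> TT U -> T <> U -> T° `&` U° = set0 &
      \bigcup_(T in TT) T = setT].

Definition vertex_to_vertex TT : Prop :=
  forall T U, TT T -> TT U -> T <> U ->
    [\/ is_edge (T `&` U) T /\ is_edge (T `&` U) U,
        exists x, T `&` U = [set x] |
        T `&` U = set0].

Definition normal TT : Prop :=
  exists r r' : R,
    [/\ 0 < r, r < r',
        forall T, TT T -> exists c, eball c r `<=` T &
        forall T, TT T -> exists c, T `<=` eball c r'].

Definition pairwise_noncongruent TT : Prop :=
  forall T U, TT T -> TT U -> T <> U -> ~ congruent T U.

(* The interiors of the pieces are disjoint as soon as TT is a tiling. *)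
Definition dissected_into4 TT S (Q : 'I_4 -> set (R * R)) : Prop :=
  [/\ forall i, TT (Q i),
      forall i j, i != j -> ~ congruent (Q i) (Q j) &
      S = \bigcup_i Q i].

End Plane.

(* Main.v *)
Require Import Defs.
From mathcomp Require Import all_boot all_order all_algebra.
From mathcomp Require Import all_classical all_reals all_analysis.
From mathcomp Require Import measurable_realfun ring lra.

Set Implicit Arguments.
Unset Strict Implicit.
Unset Printing Implicit Defensive.

Import Order.TTheory GRing.Theory Num.Theory.
Import numFieldNormedType.Exports.

Local Open Scope classical_set_scope.
Local Open Scope ring_scope.

(** The plane is cut into squares of side 2, and each square into four convex
    quadrangles of area 1 by a dissection with one free real parameter.  The
    dissection of the model square with corners A = (0, 0), B = (2, 0),
    C = (2, 2), D = (0, 2) uses one subdivision point M on the bottom side, one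
    subdivision point N on the top side, none on the vertical sides, and two
    inner points P and Q:
      DAMP,  MBQP,  BCNQ,  NDPQ.
    With M and N fixed, P and Q have four coordinates.  Area 1 for DAMP keeps P
    on a line parallel to DM, area 1 for BCNQ keeps Q on a line parallel to BN,
    and area 1 for MBQP ties the two positions u and v together; the last area
    is then 1 because the total is 4.  One degree of freedom is left although
    the boundary of the square is subdivided in a fixed way, so every square of
    the plane may use its own value of u, as close as wanted to u = 1 / 2.
    Neighbours in a row share whole vertical sides.  Neighbours in a column
    would disagree on the subdivision point, since M and N have different
    abscissas; every other row is therefore reflected in a horizontal line.

    The four shapes of a dissection are told apart, and so are two shapes
    with different values of u, by a congruence invariant: the sum [spread] of
    the squared distances between vertices.  It is invariant because isometries
    preserve midpoints, hence extreme points, and the extreme points of a convex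
    polygon are its vertices ([congruent_spread]).  Near u = 1 / 2 the four
    spreads take values in disjoint intervals ([spread_piece_range]), and each is
    strictly increasing in u ([spread_piece_lt]).

    Two distinct tiles either share a side traversed in opposite directions, and
    then convexity makes that side their whole intersection
    ([share_side_inter]), or they have at most one common point: this is
    [tiles_meet], which yields both disjointness of interiors and the
    vertex-to-vertex property.  Areas come from Fubini for triangles
    ([area_triangle]).  Normality holds because the orientation determinants of
    all pieces are bounded below uniformly in u ([piece_fat], [fat_ball]). *)

(** * Affine forms and faces of convex hulls *)

Section AffineForms.
Context {R : realType}.
Implicit Types (x y z : R * R).

Definition aff (l m n : R) x := l * x.1 + m * x.2 + n.

Lemma orient_aff a b x :
  orient a b x =
  aff (a.2 - b.2) (b.1 - a.1) ((b.2 - a.2) * a.1 - (b.1 - a.1) * a.2) x.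
Proof. rewrite /orient /aff; ring. Qed.

Lemma fst_comb n (w : 'I_n -> R) (p : 'I_n -> R * R) :
  (\sum_i w i *: p i).1 = \sum_i w i * (p i).1.
Proof. by rewrite (raddf_sum fst). Qed.

Lemma snd_comb n (w : 'I_n -> R) (p : 'I_n -> R * R) :
  (\sum_i w i *: p i).2 = \sum_i w i * (p i).2.
Proof. by rewrite (raddf_sum snd). Qed.

Lemma aff_comb l m k n (w : 'I_n -> R) (p : 'I_n -> R * R) :
  \sum_i w i = 1 ->
  aff l m k (\sum_i w i *: p i) = \sum_i w i * aff l m k (p i).
Proof.
move=> w1; rewrite /aff fst_comb snd_comb -[k in LHS]mulr1 -w1 !mulr_sumr.
rewrite -!big_split /=; apply: eq_bigr => i _; ring.
Qed.

Lemma hull_comb3 n (p : 'I_n -> R * R) i j k (r s t : R) :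
  0 <= r -> 0 <= s -> 0 <= t -> r + s + t = 1 ->
  conv_hull p (r *: p i + s *: p j + t *: p k).
Proof.
move=> r0 s0 t0 rst1; pose e (i l : 'I_n) : R := (l == i)%:R.
have e1 i0 : \sum_l e i0 l = 1.
  by rewrite (bigD1 i0) //= /e eqxx big1 ?addr0 // => l /negPf ->.
have ep i0 : \sum_l e i0 l *: p l = p i0.
  rewrite (bigD1 i0) //= /e eqxx scale1r big1 ?addr0 // => l /negPf ->.
  by rewrite scale0r.
exists (fun l => r * e i l + s * e j l + t * e k l); split=> [l||].
- by rewrite !addr_ge0 // mulr_ge0 // ler0n.
- by rewrite !big_split /= -!mulr_sumr !e1 !mulr1.
- under eq_bigr do rewrite !scalerDl -!scalerA.
  by rewrite !big_split /= -!scaler_sumr !ep.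
Qed.

Lemma hull_ge0 l m k n (p : 'I_n -> R * R) x :
  (forall i, 0 <= aff l m k (p i)) -> conv_hull p x -> 0 <= aff l m k x.
Proof.
move=> gp [w [w0 w1 ->]]; rewrite aff_comb //.
by apply: sumr_ge0 => i _; rewrite mulr_ge0.
Qed.

(** A convex combination of nonnegative values that is not positive has
    no weight on the positive ones: points of a supporting line are combinations
    of the vertices on that line. *)
Lemma face_weights l m k n (p : 'I_n -> R * R) (w : 'I_n -> R) :
  (forall i, 0 <= w i) -> \sum_i w i = 1 ->
  (forall i, 0 <= aff l m k (p i)) ->
  aff l m k (\sum_i w i *: p i) <= 0 ->
  forall i, 0 < aff l m k (p i) -> w i = 0.
Proof.
move=> w0 w1 gp; rewrite aff_comb // => le0 i gi.
have t0 j : 0 <= w j * aff l m k (p j) by rewrite mulr_ge0.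
have s0 : \sum_j w j * aff l m k (p j) = 0.
  by apply/eqP; rewrite eq_le le0 sumr_ge0.
have /(_ i isT)/eqP := psumr_eq0P (fun j _ => t0 j) s0.
by rewrite mulf_eq0 (gt_eqF gi) orbF => /eqP.
Qed.

Lemma hull_gt0 l m k n (p : 'I_n -> R * R) x :
  (forall i, 0 < aff l m k (p i)) -> conv_hull p x -> 0 < aff l m k x.
Proof.
move=> gp [w [w0 w1 ->]]; rewrite ltNge; apply/negP => le0.
have wz := face_weights w0 w1 (fun i => ltW (gp i)) le0.
have : \sum_i w i = 0 by apply: big1 => i _; apply: wz.
by rewrite w1 => /eqP; rewrite oner_eq0.
Qed.

Lemma hull_face1 l m k n (p : 'I_n -> R * R) i0 x :
  0 <= aff l m k (p i0) -> (forall i, i != i0 -> 0 < aff l m k (p i)) ->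
  conv_hull p x -> aff l m k x <= 0 -> x = p i0.
Proof.
move=> g0 gp [w [w0 w1 ->]] le0.
have ge0 i : 0 <= aff l m k (p i) by case: (eqVneq i i0) => [->//|/gp/ltW].
have wz := face_weights w0 w1 ge0 le0.
have w01 : w i0 = 1.
  by rewrite -w1 (bigD1 i0) //= big1 ?addr0 // => i /gp /wz.
rewrite (bigD1 i0) //= w01 scale1r big1 ?addr0 // => i /gp /wz ->.
by rewrite scale0r.
Qed.

Lemma hull_face2 l m k n (p : 'I_n -> R * R) i1 i2 x :
  i2 != i1 ->
  (forall i, 0 <= aff l m k (p i)) ->
  (forall i, i != i1 -> i != i2 -> 0 < aff l m k (p i)) ->
  conv_hull p x -> aff l m k x <= 0 -> segment (p i1) (p i2) x.
Proof.
move=> i12 ge0 gp [w [w0 w1 ->]] le0.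
have wz := face_weights w0 w1 ge0 le0.
have w12 : w i1 = 1 - w i2.
  rewrite -w1 (bigD1 i1) //= (bigD1 i2) //= [X in _ + (_ + X)]big1 ?addr0.
    by rewrite addrK.
  by move=> i /andP[ni1 ni2]; apply: wz; apply: gp.
exists (w i2); first by rewrite w0 -subr_ge0 -w12 w0.
rewrite -w12 (bigD1 i1) //= (bigD1 i2) //= [X in _ + (_ + X)]big1 ?addr0 //.
by move=> i /andP[ni1 ni2]; rewrite wz ?scale0r //; apply: gp.
Qed.

Lemma segment_sub_hull n (p : 'I_n -> R * R) i j :
  segment (p i) (p j) `<=` conv_hull p.
Proof.
move=> x [t /andP[t0 t1] ->].
have := @hull_comb3 n p i j j (1 - t) t 0; rewrite scale0r !addr0 subrK => h.
by apply: h; rewrite ?subr_ge0.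
Qed.

Lemma segmentC a b : segment a b = segment b a :> set (R * R).
Proof.
have sub a' b' : segment a' b' `<=` (segment b' a' : set (R * R)).
  move=> x [t /andP[t0 t1] ->]; exists (1 - t).
    by rewrite subr_ge0 t1 lerBlDr lerDl t0.
  by rewrite opprB addrCA subrr addr0 addrC.
by apply/seteqP; split; apply: sub.
Qed.

(** An affine form that vanishes on a nonempty open set is constant: moving along
    its gradient changes its value. *)
Lemma separated_interiors l m k (T U : set (R * R)) :
  (l != 0) || (m != 0) ->
  (forall x, T x -> 0 <= aff l m k x) -> (forall x, U x -> aff l m k x <= 0) ->
  T° `&` U° = set0.
Proof.
move=> lm0 gT gU; apply/seteqP; split=> // x [Tx Ux].
have g0 y : (T° `&` U°) y -> aff l m k y = 0.
  move=> [/interior_subset/gT g1 /interior_subset/gU g2].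
  by apply/eqP; rewrite eq_le g1 g2.
have oTU : open (T° `&` U°) by apply: openI; apply: open_interior.
have /nbhs_ballP[e /= e0 be] : nbhs x (T° `&` U°) by apply: open_nbhs_nbhs; split.
pose c := 1 + `|l| + `|m|.
have c0 : 0 < c by rewrite /c; have := normr_ge0 l; have := normr_ge0 m; lra.
(* a step along the gradient that stays in the ball of radius e *)
pose d := e / c / 2.
have d0 : 0 < d by rewrite !divr_gt0.
have dc : d * c < e by rewrite /d mulrAC divfK ?gt_eqF //; lra.
have bx : ball x e (x.1 + d * l, x.2 + d * m).
  split; rewrite /ball /= opprD addNKr normrN normrM (gtr0_norm d0).
    apply: le_lt_trans dc; rewrite ler_pM2l // /c.
    by have := normr_ge0 m; lra.
  apply: le_lt_trans dc; rewrite ler_pM2l // /c.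
  by have := normr_ge0 l; lra.
have := g0 _ (be _ bx); have := g0 x (conj Tx Ux); rewrite /aff /= => g1 g2.
have : d * (l ^+ 2 + m ^+ 2) = 0 by rewrite -[RHS]subr0 -{1}g2 -g1; ring.
move/eqP; rewrite mulf_eq0 (gt_eqF d0) /= paddr_eq0 ?sqr_ge0 // !sqrf_eq0.
by move=> /andP[/eqP l0 /eqP m0]; rewrite l0 m0 eqxx in lm0.
Qed.

End AffineForms.

(** * Sides of convex polygons *)

Section ConvexPolygons.
Context {R : realType}.
Implicit Types (a b c d x y : R * R).

Lemma orient_rot a b c : orient b c a = orient a b c.
Proof. rewrite /orient; ring. Qed.

Lemma orient_swap a b c : orient b a c = - orient a b c.
Proof. rewrite /orient; ring. Qed.

Lemma orient_aab a b : orient a b a = 0.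
Proof. rewrite /orient; ring. Qed.

Lemma orient_abb a b : orient a b b = 0.
Proof. rewrite /orient; ring. Qed.

Lemma ordS_neq n (i : 'I_n) : (1 < n)%N -> ordS i != i.
Proof.
move=> n1; apply/eqP => /(congr1 val) /=.
have := ltn_ord i; rewrite leq_eqVlt => /orP[/eqP E|lt].
  by rewrite {1}E modnn => i0; move: n1; rewrite -E -i0.
by rewrite modn_small // => /esym/n_Sn.
Qed.

Lemma ordSS_neq n (i : 'I_n) : (2 < n)%N -> ordS (ordS i) != i.
Proof.
move=> n2; apply/eqP => /(congr1 val) /=.
have := ltn_ord i; rewrite leq_eqVlt => /orP[/eqP E|lt].
  by rewrite {1}E modnn modn_small ?(ltnW n2) // => i1; move: n2; rewrite -E -i1.
rewrite (modn_small lt); move: lt; rewrite leq_eqVlt => /orP[/eqP E|lt].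
  by rewrite E modnn => i0; move: n2; rewrite -E -i0.
by rewrite modn_small // => E; have := leqnSn i.+1; rewrite E ltnn.
Qed.

Lemma convex_side_ge0 n (p : 'I_n -> R * R) i j :
  convex_vertices p -> 0 <= orient (p i) (p (ordS i)) (p j).
Proof.
move=> [_ cp]; case: (eqVneq j i) => [->|ji]; first by rewrite orient_aab.
case: (eqVneq j (ordS i)) => [->|jSi]; first by rewrite orient_abb.
exact/ltW/cp.
Qed.

Lemma hull_side_ge0 n (p : 'I_n -> R * R) i x :
  convex_vertices p -> conv_hull p x -> 0 <= orient (p i) (p (ordS i)) x.
Proof.
move=> cp; rewrite orient_aff; apply: hull_ge0 => j.
by rewrite -orient_aff; apply: convex_side_ge0.
Qed.

Lemma convex_side_neq n (p : 'I_n -> R * R) i :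
  convex_vertices p -> p i != p (ordS i).
Proof.
move=> [n2 cp].
have [j ji jSi] : exists2 j, j != i & j != ordS i.
  have : exists j, j \in ~: [set i; ordS i].
    apply/set0Pn; rewrite -card_gt0 cardsCs finset.setCK card_ord subn_gt0.
    by rewrite (leq_ltn_trans _ n2) // cards2; case: (_ != _).
  by case=> j; rewrite !inE negb_or => /andP[]; exists j.
apply/eqP => E; have := cp i j ji jSi.
by rewrite -E /orient !subrr !mul0r subrr ltxx.
Qed.

Lemma is_edge_side n (p : 'I_n -> R * R) i :
  convex_vertices p -> is_edge (segment (p i) (p (ordS i))) (conv_hull p).
Proof. by move=> cp; exists n, p; split=> //; exists i. Qed.

(** Both polygons run counterclockwise, so that they traverse a side that separates
    them in opposite directions. *)
Definition share_side m n (p : 'I_m -> R * R) (q : 'I_n -> R * R) :=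
  exists i j, p i = q (ordS j) /\ p (ordS i) = q j.

Lemma share_sideC m n (p : 'I_m -> R * R) (q : 'I_n -> R * R) :
  share_side p q -> share_side q p.
Proof. by move=> [i [j [h1 h2]]]; exists j, i. Qed.

Lemma share_side_interiors m n (p : 'I_m -> R * R) (q : 'I_n -> R * R) :
  convex_vertices p -> convex_vertices q -> share_side p q ->
  (conv_hull p)° `&` (conv_hull q)° = set0.
Proof.
move=> cp cq [i [j [h1 h2]]].
apply: (@separated_interiors _ ((p i).2 - (p (ordS i)).2)
  ((p (ordS i)).1 - (p i).1)
  (((p (ordS i)).2 - (p i).2) * (p i).1 - ((p (ordS i)).1 - (p i).1) * (p i).2)).
- have := convex_side_neq i cp; rewrite !subr_eq0.
  apply: contraNT; rewrite negb_or !negbK => /andP[/eqP e1 /eqP e2].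
  by apply/eqP; case: (p i) (p (ordS i)) e1 e2 => [? ?] [? ?] /= -> ->.
- by move=> x; rewrite -orient_aff; apply: hull_side_ge0.
- by move=> x; rewrite -orient_aff h1 h2 orient_swap oppr_le0; apply: hull_side_ge0.
Qed.

(** Both polygons touch the line of the common side exactly along that side, and
    lie in opposite half-planes. *)
Lemma share_side_inter m n (p : 'I_m -> R * R) (q : 'I_n -> R * R) :
  convex_vertices p -> convex_vertices q -> share_side p q ->
  is_edge (conv_hull p `&` conv_hull q) (conv_hull p) /\
  is_edge (conv_hull p `&` conv_hull q) (conv_hull q).
Proof.
move=> cp cq [i [j [h1 h2]]].
suff E : conv_hull p `&` conv_hull q = segment (p i) (p (ordS i)).
  split; first by rewrite E; apply: is_edge_side.
  by rewrite E h1 h2 segmentC; apply: is_edge_side.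
apply/seteqP; split=> [x [px qx]|x sx]; last first.
  split; first exact: segment_sub_hull sx.
  by rewrite h1 h2 segmentC in sx; apply: segment_sub_hull sx.
have le0 : orient (p i) (p (ordS i)) x <= 0.
  by rewrite h1 h2 orient_swap oppr_le0; apply: hull_side_ge0.
rewrite orient_aff in le0; apply: hull_face2 px le0.
- by apply: ordS_neq; case: cp => + _; apply: ltn_trans.
- by move=> k; rewrite -orient_aff; apply: convex_side_ge0.
- by move=> k ki kS; rewrite -orient_aff; apply: cp.2.
Qed.

End ConvexPolygons.

(** * Convex quadrangles as intersections of half-planes *)

Section Quadrilaterals.
Context {R : realType}.
Implicit Types (a b c d x y : R * R) (p : 'I_4 -> R * R).

Definition quad a b c d : 'I_4 -> R * R := fun i => nth a [:: a; b; c; d] i.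

(** Quantitative convexity: a lower bound that holds for a whole family of
    quadrangles gives a common inscribed radius. *)
Definition fat e (p : 'I_4 -> R * R) := forall i j, j != i -> j != ordS i ->
  e <= orient (p i) (p (ordS i)) (p j).

Lemma fat_convex e p : 0 < e -> fat e p -> convex_vertices p.
Proof. by move=> e0 fp; split=> // i j ji jS; apply: lt_le_trans e0 (fp _ _ ji jS). Qed.

Lemma fat_quad e a b c d :
  e <= orient a b c -> e <= orient b c d -> e <= orient c d a ->
  e <= orient d a b -> fat e (quad a b c d).
Proof.
move=> h1 h2 h3 h4 [[|[|[|[|//]]]] Hi] [[|[|[|[|//]]]] Hj] //= _ _.
all: rewrite /quad /=.
all: first [assumption | rewrite orient_rot; assumption
          | rewrite -orient_rot; assumption].
Qed.

Lemma forall_I4 (P : 'I_4 -> Prop) :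
  (forall i, P i) <-> [/\ P 0, P 1, P 2%:R & P 3%:R].
Proof.
split=> [h|[h0 h1 h2 h3] i]; first by split.
have : i \in [:: 0; 1; 2%:R; 3%:R] by case: i => [[|[|[|[|//]]]] Hi].
by rewrite !inE => /or4P[] /eqP ->.
Qed.

Lemma quadE (p : 'I_4 -> R * R) : p = quad (p 0) (p 1) (p 2%:R) (p 3%:R).
Proof. by apply/funext; apply/forall_I4; split. Qed.

Lemma coordE :
  ((forall x y : R * R, (x + y).1 = x.1 + y.1) *
   (forall x y : R * R, (x + y).2 = x.2 + y.2)) *
  ((forall (k : R) (x : R * R), (k *: x).1 = k * x.1) *
   (forall (k : R) (x : R * R), (k *: x).2 = k * x.2)).
Proof. by []. Qed.

Lemma eq_coord (x y : R * R) : x.1 = y.1 -> x.2 = y.2 -> x = y.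
Proof. by case: x y => [? ?] [? ?] /= -> ->. Qed.

Lemma barycentric a b c x : orient a b c != 0 ->
  x = (orient b c x / orient a b c) *: a + (orient c a x / orient a b c) *: b +
      (orient a b x / orient a b c) *: c.
Proof.
rewrite /orient => D0; apply: eq_coord; rewrite !coordE; field; exact: D0.
Qed.

Definition triangle a b c : set (R * R) :=
  [set z | [/\ 0 <= orient a b z, 0 <= orient b c z & 0 <= orient c a z]].

Lemma triangle_sub_hull n (p : 'I_n -> R * R) i j k :
  0 < orient (p i) (p j) (p k) -> triangle (p i) (p j) (p k) `<=` conv_hull p.
Proof.
move=> D0 z [ij jk ki]; rewrite (@barycentric (p i) (p j) (p k) z) ?gt_eqF //.
apply: hull_comb3; rewrite ?divr_ge0 ?(ltW D0) // -!mulrDl.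
rewrite (_ : _ + _ + _ = orient (p i) (p j) (p k)) ?divff ?gt_eqF //.
by rewrite /orient; ring.
Qed.

Lemma ordS4 : ((ordS 0 = 1 :> 'I_4) * (ordS 1 = 2%:R :> 'I_4)) *
  ((ordS 2%:R = 3%:R :> 'I_4) * (ordS 3%:R = 0 :> 'I_4)).
Proof. by do !split; apply: val_inj. Qed.

Lemma convex_vertices4 p : convex_vertices p <->
  [/\ 0 < orient (p 0) (p 1) (p 2%:R), 0 < orient (p 1) (p 2%:R) (p 3%:R),
      0 < orient (p 2%:R) (p 3%:R) (p 0) & 0 < orient (p 3%:R) (p 0) (p 1)].
Proof.
split=> [[_ cp]|[h0 h1 h2 h3]].
  split.
  - by have := cp 0 2%:R isT isT; rewrite ordS4.
  - by have := cp 1 3%:R isT isT; rewrite ordS4.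
  - by have := cp 2%:R 0 isT isT; rewrite ordS4.
  - by have := cp 3%:R 1 isT isT; rewrite ordS4.
pose e := Num.min (Num.min (orient (p 0) (p 1) (p 2%:R)) (orient (p 1) (p 2%:R) (p 3%:R)))
  (Num.min (orient (p 2%:R) (p 3%:R) (p 0)) (orient (p 3%:R) (p 0) (p 1))).
apply: (@fat_convex e); first by rewrite !lt_min h0 h1 h2 h3.
by rewrite (quadE p); apply: fat_quad; rewrite !ge_min lexx ?orbT.
Qed.

(** The diagonal from p 0 to p 2 decides which triangle contains the point. *)
Lemma halfplanes_triangles p z :
  (forall i, 0 <= orient (p i) (p (ordS i)) z) ->
  triangle (p 0) (p 1) (p 2%:R) z \/ triangle (p 2%:R) (p 3%:R) (p 0) z.
Proof.
move=> h.
have [ab bc cd da] : [/\ 0 <= orient (p 0) (p 1) z, 0 <= orient (p 1) (p 2%:R) z,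
    0 <= orient (p 2%:R) (p 3%:R) z & 0 <= orient (p 3%:R) (p 0) z].
  split.
  - by have := h 0; rewrite ordS4.
  - by have := h 1; rewrite ordS4.
  - by have := h 2%:R; rewrite ordS4.
  - by have := h 3%:R; rewrite ordS4.
have [ca|/ltW ac] := lerP 0 (orient (p 2%:R) (p 0) z); [left|right]; split=> //.
by rewrite orient_swap oppr_ge0.
Qed.

Lemma hull_triangles p : convex_vertices p ->
  conv_hull p = triangle (p 0) (p 1) (p 2%:R) `|` triangle (p 2%:R) (p 3%:R) (p 0).
Proof.
move=> cp; have [h0 _ h2 _] := (convex_vertices4 p).1 cp.
apply/seteqP; split=> [z hz|z [] hz]; last first.
- exact: triangle_sub_hull hz.
- exact: triangle_sub_hull hz.
by apply: halfplanes_triangles => i; apply: hull_side_ge0.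
Qed.

Lemma hull_halfplanes p : convex_vertices p ->
  conv_hull p = [set x | forall i, 0 <= orient (p i) (p (ordS i)) x].
Proof.
move=> cp; apply/seteqP; split=> [x px i|x /= h]; first exact: hull_side_ge0.
by rewrite hull_triangles //; apply: halfplanes_triangles.
Qed.

End Quadrilaterals.

(** * Area of trapezoids *)

Section Area.
Context {R : realType}.
Implicit Types (a b c d z : R * R) (A B : set (R * R)).
Local Notation mu := (@lebesgue_measure R).

Lemma integral_affine (x0 x1 k n : R) : x0 <= x1 ->
  (\int[mu]_(x in `[x0, x1]) (k * x + n)%:E =
   ((x1 - x0) * (k * (x0 + x1) / 2 + n))%:E)%E.
Proof.
rewrite le_eqVlt => /predU1P[<-|x01].
  by rewrite set_itv1 integral_set1 subrr mul0r.
pose F (x : R) : R := k / 2 * x ^+ 2 + n * x.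
have dF (x : R) : is_derive x (1 : R) F (k * x + n).
  by apply: is_derive_eq; rewrite /GRing.scale /=; field.
have cF : continuous F.
  move=> x; apply: differentiable_continuous; apply/derivable1_diffP.
  exact: (@ex_derive _ _ _ _ _ _ _ (dF x)).
rewrite (@continuous_FTC2 _ _ F) //.
- by rewrite -EFinD /F; congr EFin; field.
- apply: continuous_subspaceT => x; apply: cvgD; last exact: cvg_cst.
  by apply: cvgM; [exact: cvg_cst|exact: cvg_id].
- split; first by move=> x _; exact: (@ex_derive _ _ _ _ _ _ _ (dF x)).
  + by apply: cvg_at_right_filter; apply: cF.
  + by apply: cvg_at_left_filter; apply: cF.
- by move=> x _; rewrite derive1E; exact: (@derive_val _ _ _ _ _ _ _ (dF x)).
Qed.

Definition trapezoid (x0 x1 k1 n1 k2 n2 : R) : set (R * R) :=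
  [set z | x0 <= z.1 <= x1 /\ k1 * z.1 + n1 <= z.2 <= k2 * z.1 + n2].

Lemma area_trapezoid x0 x1 k1 n1 k2 n2 : x0 <= x1 ->
  (forall t, x0 <= t <= x1 -> k1 * t + n1 <= k2 * t + n2) ->
  area (trapezoid x0 x1 k1 n1 k2 n2) =
  ((x1 - x0) * ((k2 - k1) * (x0 + x1) / 2 + (n2 - n1)))%:E.
Proof.
move=> x01 lh; rewrite /area /product_measure1 -integral_affine //.
rewrite [RHS]integral_mkcond; apply: eq_integral => x _ /=; rewrite patchE.
case: ifPn => [|].
  rewrite inE /= in_itv /= => xin.
  have -> : xsection (trapezoid x0 x1 k1 n1 k2 n2) x =
      `[k1 * x + n1, k2 * x + n2]%classic.
    apply/seteqP; split=> y; rewrite /xsection /= in_itv /=.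
      by rewrite inE => -[].
    by move=> ?; rewrite inE.
  rewrite lebesgue_measure_itv /= lte_fin; case: ltP => [_|].
    by rewrite -EFinB; congr EFin; ring.
  by move=> hl; have lh' := lh _ xin; congr EFin; lra.
rewrite notin_setE /= in_itv /= => /negP xout.
rewrite (_ : xsection _ _ = set0) ?measure0 //.
apply/seteqP; split=> y //; rewrite /xsection /= inE => -[/= xin].
by rewrite xin in xout.
Qed.

Lemma measurable_aff (l m n : R) : measurable_fun setT (aff l m n).
Proof.
rewrite /aff; apply: measurable_funD; last exact: measurable_cst.
by apply: measurable_funD; apply: measurable_funM.
Qed.

Lemma measurable_halfplane (l m n : R) : measurable [set z | 0 <= aff l m n z].
Proof.
rewrite -[X in measurable X]setTI.
by apply: measurable_fun_le => //; exact: measurable_aff.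
Qed.

Lemma area_setU A B : measurable A -> measurable B -> area (A `&` B) = 0%E ->
  area (A `|` B) = (area A + area B)%E.
Proof.
move=> mA mB AB0; rewrite /area.
have -> : A `|` B = A `|` (B `\` A).
  apply/seteqP; split=> z [Az|Bz]; first by left.
  - by have [?|?] := pselect (A z); [left|right].
  - by left.
  - by right; case: Bz.
rewrite measureU //; [|exact: measurableD|]; last first.
  by apply/seteqP; split=> // z [Az []].
congr (_ + _)%E.
have E : B = (B `\` A) `|` (A `&` B).
  apply/seteqP; split=> z; last by move=> [[]|[]].
  by move=> Bz; have [?|?] := pselect (A z); [right|left].
rewrite [in RHS]E measureU0 //; first exact: measurableD.
exact: measurableI.
Qed.

End Area.

(** * Area of triangles *)

Section PolygonArea.
Context {R : realType}.
Implicit Types (a b c d e z : R * R).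

Lemma triangle_rot a b c : triangle b c a = triangle a b c.
Proof. by apply/seteqP; split=> z []; split. Qed.

Lemma measurable_triangle a b c : measurable (triangle a b c).
Proof.
rewrite (_ : triangle a b c = [set z | 0 <= orient a b z] `&`
  [set z | 0 <= orient b c z] `&` [set z | 0 <= orient c a z]).
  by do 2?apply: measurableI; under eq_set do rewrite orient_aff;
    apply: measurable_halfplane.
by apply/seteqP; split=> z; [case|move=> [[]]].
Qed.

Lemma area_vertical_line (k : R) : area [set z | z.1 = k] = 0%E.
Proof.
rewrite (_ : [set z | _] = [set k] `*` setT).
  rewrite /area; have := @product_measure1E _ _ _ _ R
    (@lebesgue_measure R) (@lebesgue_measure R) [set k] setT.
  by move=> -> //; rewrite [X in (X * _)%E]lebesgue_measure_set1 mul0e.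
by apply/seteqP; split=> z /=; [|case].
Qed.

(** A triangle with a vertical side is a trapezoid with one side shrunk to a
    point. *)
Lemma area_triangle_vertical a b c : b.1 = c.1 -> 0 < orient a b c ->
  area (triangle a b c) = (orient a b c / 2)%:E.
Proof.
case: a b c => [a1 a2] [k b2] [_ c2] /= <-.
rewrite {1}/orient /= => O0.
have {}O0 : 0 < (k - a1) * (c2 - b2) by move: O0; congr (0 < _); ring.
have D0 : k - a1 != 0 by apply: contraTneq O0 => ->; rewrite mul0r ltxx.
(* the slopes of the two sides through a *)
pose s := (b2 - a2) / (k - a1); pose t := (c2 - a2) / (k - a1).
have Eb : b2 = a2 + s * (k - a1) by rewrite /s divfK // addrC subrK.
have Ec : c2 = a2 + t * (k - a1) by rewrite /t divfK // addrC subrK.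
move: s t Eb Ec O0 => s t -> -> {b2 c2}.
rewrite [X in 0 < X](_ : _ = (k - a1) ^+ 2 * (t - s)); last by ring.
rewrite pmulr_rgt0 ?exprn_even_gt0 // subr_gt0 => st.
have Eab z : orient (a1, a2) (k, a2 + s * (k - a1)) z =
    (k - a1) * (z.2 - (s * z.1 + (a2 - s * a1))) by rewrite /orient /=; ring.
have Ebc z : orient (k, a2 + s * (k - a1)) (k, a2 + t * (k - a1)) z =
    (t - s) * ((k - a1) * (k - z.1)) by rewrite /orient /=; ring.
have Eca z : orient (k, a2 + t * (k - a1)) (a1, a2) z =
    (k - a1) * (t * z.1 + (a2 - t * a1) - z.2) by rewrite /orient /=; ring.
have [ak|ka|E] := ltgtP a1 k; last by rewrite E subrr eqxx in D0.
- rewrite (_ : triangle _ _ _ =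
      trapezoid a1 k s (a2 - s * a1) t (a2 - t * a1)).
    rewrite area_trapezoid ?ltW //.
      by congr EFin; rewrite /orient /=; field.
    by move=> x /andP[x1 x2]; nra.
  apply/seteqP; split=> z; rewrite /triangle /trapezoid /= Eab Ebc Eca.
    rewrite !pmulr_rge0 ?subr_gt0 // => -[h1 h2 h3]; split; last by lra.
    by apply/andP; split; nra.
  move=> [/andP[h1 h2] /andP[h3 h4]].
  by rewrite !pmulr_rge0 ?subr_gt0 //; split; lra.
- have hk : k - a1 < 0 by lra.
  have hts : 0 < t - s by lra.
  rewrite (_ : triangle _ _ _ =
      trapezoid k a1 t (a2 - t * a1) s (a2 - s * a1)).
    rewrite area_trapezoid ?ltW //.
      by congr EFin; rewrite /orient /=; field.
    by move=> x /andP[x1 x2]; nra.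
  apply/seteqP; split=> z; rewrite /triangle /trapezoid /= Eab Ebc Eca.
    rewrite (pmulr_rge0 _ hts) !(nmulr_rge0 _ hk).
    move=> [h1 h2 h3]; split; last by lra.
    by apply/andP; split; nra.
  move=> [/andP[h1 h2] /andP[h3 h4]].
  by rewrite (pmulr_rge0 _ hts) !(nmulr_rge0 _ hk); split; lra.
Qed.

(** The vertical line through c meets the side ab at a point e and cuts the
    triangle into two triangles with the vertical side ec. *)
Lemma area_triangle_middle a b c :
  a.1 < c.1 < b.1 \/ b.1 < c.1 < a.1 -> 0 < orient a b c ->
  area (triangle a b c) = (orient a b c / 2)%:E.
Proof.
move=> mid O0.
have ab : b.1 - a.1 != 0.
  by rewrite subr_eq0; apply/eqP => E; case: mid => /andP[h1 h2]; lra.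
pose t := (c.1 - a.1) / (b.1 - a.1).
have Et : t * (b.1 - a.1) = c.1 - a.1 by rewrite divfK.
have /andP[t0 t1] : 0 < t < 1.
  by case: mid => /andP[h1 h2]; apply/andP; split; nra.
pose e : R * R := (c.1, a.2 + t * (b.2 - a.2)).
have ec : e.1 = a.1 + t * (b.1 - a.1) by rewrite Et addrC subrK.
have e2 : e.2 = a.2 + t * (b.2 - a.2) by [].
have Ea z : orient a e z = t * orient a b z by rewrite /orient ec e2; ring.
have Eb z : orient e b z = (1 - t) * orient a b z
  by rewrite /orient ec e2; ring.
have Eec z : orient e c z = (1 - t) * orient a c z + t * orient b c z.
  by rewrite /orient ec e2; ring.
have tt : 0 < 1 - t by lra.
have -> : triangle a b c = triangle a e c `|` triangle e b c.
  apply/seteqP; split=> z.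
    move=> [h1 h2 h3]; have [h|/ltW h] := lerP 0 (orient e c z); [left|right].
      by split=> //; rewrite Ea pmulr_rge0.
    by split=> //; [rewrite Eb pmulr_rge0|rewrite orient_swap oppr_ge0].
  move=> [[]|[]]; rewrite ?Ea ?Eb pmulr_rge0 // => h1 h2 h3; split=> //.
    by move: h2 h3; rewrite Eec (orient_swap a c) oppr_ge0 => h2 h3; nra.
  by move: h3; rewrite orient_swap oppr_ge0 Eec (orient_swap c a) => h3; nra.
rewrite area_setU; [|exact: measurable_triangle|exact: measurable_triangle|].
  have -> : area (triangle a e c) = (t * orient a b c / 2)%:E.
    by rewrite area_triangle_vertical // Ea // mulr_gt0.
  have -> : area (triangle e b c) = ((1 - t) * orient a b c / 2)%:E.
    by rewrite -triangle_rot area_triangle_vertical // orient_rot Eb // mulr_gt0.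
  by rewrite -EFinD; congr EFin; field.
apply/eqP; rewrite -measure_le0 /=.
have <- := area_vertical_line c.1.
apply: le_measure; rewrite ?inE.
- by apply: measurableI; apply: measurable_triangle.
- rewrite -[X in measurable X]setTI.
  exact: (measurable_fst measurableT _ (measurable_set1 _)).
move=> z [[_ h1 _] [_ _ h2]]; rewrite orient_swap oppr_ge0 in h2.
have : orient e c z = 0 by apply/eqP; rewrite eq_le h1 h2.
rewrite /orient /= subrr mul0r sub0r => /eqP; rewrite oppr_eq0 mulf_eq0.
case/orP => [/eqP h|]; last by rewrite subr_eq0 => /eqP.
have : orient a e c = 0 by rewrite /orient /= ; nra.
by rewrite Ea => /eqP; rewrite mulf_eq0 (gt_eqF t0) (gt_eqF O0).
Qed.

Lemma area_triangle a b c : 0 < orient a b c ->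
  area (triangle a b c) = (orient a b c / 2)%:E.
Proof.
move=> O0.
have [/area_triangle_vertical->//|bc] := eqVneq b.1 c.1.
have [ca|ca] := eqVneq c.1 a.1.
  by rewrite -triangle_rot area_triangle_vertical // orient_rot.
have [ab|ab] := eqVneq a.1 b.1.
  by rewrite triangle_rot area_triangle_vertical // -orient_rot.
have rot1 := area_triangle_middle (a := b) (b := c) (c := a).
have rot2 := area_triangle_middle (a := c) (b := a) (c := b).
rewrite orient_rot triangle_rot in rot1.
rewrite -orient_rot -triangle_rot in rot2.
have [m|[m|m]] : (a.1 < c.1 < b.1 \/ b.1 < c.1 < a.1) \/
    (b.1 < a.1 < c.1 \/ c.1 < a.1 < b.1) \/
    (c.1 < b.1 < a.1 \/ a.1 < b.1 < c.1).
- case/orP: (lt_total ab) => h1; case/orP: (lt_total bc) => h2;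
    case/orP: (lt_total ca) => h3; rewrite ?h1 ?h2 ?h3 /=;
    first [by (do 2!left) | by (left; right) | by (right; do 2!left)
          | by (right; left; right) | by (do 2!right; left) | by (do 3!right)
          | exfalso; lra].
- exact: area_triangle_middle.
- exact: rot1.
- exact: rot2.
Qed.

End PolygonArea.

(** * Area and compactness of convex quadrangles *)

Section ConvexQuadrilaterals.
Context {R : realType}.
Implicit Types (a b c d z : R * R) (p : 'I_4 -> R * R).

Lemma area_graph (k n : R) : area [set z | z.2 = k * z.1 + n] = 0%E.
Proof.
rewrite /area /product_measure1 integral0_eq // => x _ /=.
rewrite (_ : xsection _ _ = [set k * x + n]); first exact: lebesgue_measure_set1.
by apply/seteqP; split=> y; rewrite /xsection /= inE.
Qed.

Lemma area_line l m n : (l != 0) || (m != 0) ->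
  area [set z : R * R | aff l m n z = 0] = 0%E.
Proof.
have [->|m0 _] := eqVneq m 0.
  rewrite orbF => l0; rewrite (_ : [set z | _] = [set z | z.1 = - n / l]).
    exact: area_vertical_line.
  apply/seteqP; split=> z; rewrite /aff /= => E; last by rewrite E; field.
  by apply: (mulfI l0); rewrite mulrCA divff // mulr1; lra.
rewrite (_ : [set z | _] = [set z | z.2 = (- l / m) * z.1 + (- n / m)]).
  exact: area_graph.
apply/seteqP; split=> z; rewrite /aff /= => E; last by rewrite E; field.
by apply: (mulfI m0); apply/eqP; rewrite -subr_eq0 -E; apply/eqP; field.
Qed.

(** The two triangles cut off by a diagonal overlap on a subset of a line. *)
Lemma area_hull p : convex_vertices p ->
  area (conv_hull p) = ((orient (p 0) (p 1) (p 2%:R) +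
                         orient (p 2%:R) (p 3%:R) (p 0)) / 2)%:E.
Proof.
move=> cp; have [h0 _ h2 _] := (convex_vertices4 p).1 cp.
rewrite hull_triangles // area_setU;
  [|exact: measurable_triangle|exact: measurable_triangle|].
  by rewrite !area_triangle // -EFinD -mulrDl.
apply/eqP; rewrite -measure_le0 /=.
have ac : ((p 0).2 - (p 2%:R).2 != 0) || ((p 2%:R).1 - (p 0).1 != 0).
  apply: contraTT h0; rewrite negb_or !negbK => /andP[/eqP h /eqP h'].
  rewrite (_ : p 2%:R = p 0) ?orient_aab ?ltxx //.
  by apply: eq_coord; lra.
have <- := area_line (((p 2%:R).2 - (p 0).2) * (p 0).1 -
                      ((p 2%:R).1 - (p 0).1) * (p 0).2) ac.
apply: le_measure; rewrite ?inE.
- by apply: measurableI; apply: measurable_triangle.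
- rewrite -[X in measurable X]setTI.
  by apply: (measurable_aff _ _ _ measurableT (measurable_set1 0)).
move=> z [[_ _ +] [_ _ h]] /=; rewrite -orient_aff orient_swap oppr_ge0 => h'.
by apply/eqP; rewrite eq_le h h'.
Qed.

Lemma continuous_aff (l m n : R) : continuous (aff l m n).
Proof.
move=> z; apply: cvgD; last exact: cvg_cst.
by apply: cvgD; apply: cvgM; try exact: cvg_cst; [exact: cvg_fst|exact: cvg_snd].
Qed.

Lemma closed_halfplane (l m n : R) : closed [set z | 0 <= aff l m n z].
Proof.
apply: (preimage_closed _ (@closed_ge _ 0)) => z _.
exact: continuous_aff.
Qed.

Lemma compact_hull p : convex_vertices p -> compact (conv_hull p).
Proof.
move=> cp.
pose m := \sum_i (`|(p i).1| + `|(p i).2|).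
have pm i : `|(p i).1| <= m /\ `|(p i).2| <= m.
  have h : `|(p i).1| + `|(p i).2| <= m.
    by rewrite /m (bigD1 i) //= lerDl sumr_ge0 // => j _; rewrite addr_ge0.
  by split; apply: le_trans h; rewrite ?lerDl ?lerDr.
apply: (@subclosed_compact _ _ (`[- m, m] `*` `[- m, m])).
- rewrite hull_halfplanes //.
  rewrite (_ : mkset _ = \bigcap_i [set z | 0 <= orient (p i) (p (ordS i)) z]).
    apply: closed_bigI => i _; under eq_set do rewrite orient_aff.
    exact: closed_halfplane.
  by apply/seteqP; split=> z h i; [move=> _; apply: h|apply: h].
- by apply: compact_setX; apply: segment_compact.
- move=> z hz; have bnd l k : (forall i, `|l * (p i).1 + k * (p i).2| <= m) ->
      - m <= l * z.1 + k * z.2 <= m.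
    move=> lk.
    have h1 : 0 <= aff l k m z.
      apply: hull_ge0 hz => i.
      by have := lk i; rewrite ler_norml /aff => /andP[? ?]; lra.
    have h2 : 0 <= aff (- l) (- k) m z.
      apply: hull_ge0 hz => i.
      by have := lk i; rewrite ler_norml /aff => /andP[? ?]; lra.
    by rewrite /aff in h1 h2; apply/andP; split; lra.
  split; rewrite /= in_itv /=.
    have := bnd 1 0; rewrite !mul1r mul0r addr0; apply=> i.
    by rewrite mul1r mul0r addr0; case: (pm i).
  have := bnd 0 1; rewrite !mul1r mul0r add0r; apply=> i.
  by rewrite mul1r mul0r add0r; case: (pm i).
Qed.

End ConvexQuadrilaterals.

(** * Inscribed and circumscribed discs *)

Section Balls.
Context {R : realType}.
Implicit Types (a b c d x y z : R * R) (p : 'I_4 -> R * R).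

Definition sqdist x y : R := (x.1 - y.1) ^+ 2 + (x.2 - y.2) ^+ 2.

Lemma edistE x y : Defs.edist x y = Num.sqrt (sqdist x y).
Proof. by rewrite /Defs.edist /dot /sqdist /= !expr2. Qed.

Lemma sqdist_ge0 x y : 0 <= sqdist x y.
Proof. by rewrite addr_ge0 // sqr_ge0. Qed.

Lemma eball_coord c x (r : R) : eball c r x ->
  `|x.1 - c.1| <= r /\ `|x.2 - c.2| <= r.
Proof.
rewrite /eball /= edistE => h.
by split; apply: le_trans h; rewrite distrC -sqrtr_sqr ler_wsqrtr //
  /sqdist ?lerDl ?lerDr sqr_ge0.
Qed.

Lemma coord_eball c x (r : R) : 0 <= r ->
  `|x.1 - c.1| <= r -> `|x.2 - c.2| <= r -> eball c (2 * r) x.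
Proof.
move=> r0 h1 h2; rewrite /eball /= edistE.
rewrite -[leRHS]ger0_norm; last by rewrite mulr_ge0.
rewrite -sqrtr_sqr ler_wsqrtr // /sqdist.
move: h1 h2; rewrite !ler_norml => /andP[? ?] /andP[? ?].
have h1 : (c.1 - x.1) ^+ 2 <= r ^+ 2 by nra.
have h2 : (c.2 - x.2) ^+ 2 <= r ^+ 2 by nra.
have := sqr_ge0 r; nra.
Qed.

Definition centroid p : R * R := (1 / 4) *: (p 0 + p 1 + p 2%:R + p 3%:R).

(** Against any side, two vertices have determinant 0 and the other two at least
    e, so that the centroid has determinant at least 2 e / 4; a move of
    the centroid by r in each coordinate changes this by at most 2 l r. *)
Lemma fat_ball (e l : R) p : 0 < e -> 0 < l -> fat e p ->
  (forall i j, `|(p i).1 - (p j).1| <= l /\ `|(p i).2 - (p j).2| <= l) ->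
  eball (centroid p) (e / (4 * l)) `<=` conv_hull p.
Proof.
move=> e0 l0 fp pl x /eball_coord; set r := e / _ => -[x1 x2].
have rl : l * r = e / 4 by rewrite /r; field; rewrite gt_eqF.
rewrite hull_halfplanes /=; last exact: fat_convex fp.
have small u v : `|u| <= l -> `|v| <= r -> - (e / 4) <= u * v.
  move=> ul vr; have : `|u * v| <= e / 4 by rewrite -rl normrM ler_pM.
  by rewrite ler_norml => /andP[].
have far i : e / 2 <= orient (p i) (p (ordS i)) (centroid p).
  move: i; apply/forall_I4; rewrite !ordS4 /centroid.
  have h i j := fp i j.
  move: (h 0 2%:R isT isT) (h 0 3%:R isT isT) (h 1 0 isT isT)
    (h 1 3%:R isT isT) (h 2%:R 0 isT isT) (h 2%:R 1 isT isT)
    (h 3%:R 1 isT isT) (h 3%:R 2%:R isT isT).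
  rewrite !ordS4 /orient !coordE.
  by move=> *; split; lra.
move=> i; have := far i; have [l1 l2] := pl (ordS i) i.
have := small _ _ l1 x2; have := small _ (- (x.1 - (centroid p).1)) l2.
by rewrite normrN => /(_ x1); rewrite /orient; lra.
Qed.

End Balls.

(** * A congruence invariant of convex polygons *)

Section Congruence.
Context {R : realType}.
Implicit Types (a b c d x y z : R * R) (T : set (R * R)).

Lemma edist_sqdist x y x' y' :
  Defs.edist x y = Defs.edist x' y' -> sqdist x y = sqdist x' y'.
Proof.
rewrite !edistE => /(congr1 (fun t => t ^+ 2)).
by rewrite !sqr_sqrtr // sqdist_ge0.
Qed.

(** Extreme points are those that are not the midpoint of two distinct points of
    T.  Midpoints are expressed by distances only (equality in the parallelogram
    inequality), so that isometries, which are not assumed affine, preserve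
    extreme points. *)
Definition extreme T x := T x /\ forall y z, T y -> T z ->
  sqdist y z = 2 * (sqdist x y + sqdist x z) -> y = z.

Lemma sqdist_midpoint x y z :
  sqdist y z = 2 * (sqdist x y + sqdist x z) <-> y + z = x + x.
Proof.
split=> [h|h].
  have : (y.1 + z.1 - (x.1 + x.1)) ^+ 2 + (y.2 + z.2 - (x.2 + x.2)) ^+ 2 = 0.
    transitivity (2 * (sqdist x y + sqdist x z) - sqdist y z).
      by rewrite /sqdist; ring.
    by rewrite h subrr.
  move/eqP; rewrite paddr_eq0 ?sqr_ge0 // !sqrf_eq0 !subr_eq0.
  by move=> /andP[/eqP h1 /eqP h2]; apply: eq_coord.
have := congr1 fst h; have := congr1 snd h; rewrite !coordE => h2 h1.
rewrite /sqdist; have -> : y.1 = x.1 + x.1 - z.1 by lra.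
have -> : y.2 = x.2 + x.2 - z.2 by lra.
by ring.
Qed.

Lemma extreme_isometry (f : R * R -> R * R) T x :
  (forall y z, sqdist (f y) (f z) = sqdist y z) ->
  extreme T x -> extreme (f @` T) (f x).
Proof.
move=> fd [Tx ex]; split; first by exists x.
by move=> _ _ [y Ty <-] [z Tz <-]; rewrite !fd => /(ex _ _ Ty Tz) ->.
Qed.

Lemma convex_vertices_inj n (p : 'I_n -> R * R) : convex_vertices p -> injective p.
Proof.
move=> cp i j E; apply/eqP; apply: contraT => ij.
have [_ cp'] := cp; case: (eqVneq j (ordS i)) => [jS|jS].
  by have := convex_side_neq i cp; rewrite -jS E eqxx.
by have := cp' i j; rewrite eq_sym -E orient_aab ltxx => /(_ ij jS).
Qed.

(** If two weights of x are positive, shifting weight between these two vertices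
    in both directions exhibits x as a midpoint. *)
Lemma extreme_vertex n (p : 'I_n -> R * R) x : injective p ->
  extreme (conv_hull p) x -> exists i, x = p i.
Proof.
move=> pinj [[w [w0 w1 Ex]] ex].
have [i wi] : exists i, 0 < w i.
  apply: contrapT => /forallNP h; suff : \sum_i w i = 0.
    by rewrite w1 => /eqP; rewrite oner_eq0.
  by apply: big1 => i _; apply/eqP; rewrite eq_le w0 leNgt andbT; apply/negP/h.
have [[j [ji wj]]|/forallNP h] := pselect (exists j, j != i /\ 0 < w j); last first.
  have wz j : j != i -> w j = 0.
    move=> ji; apply/eqP; rewrite eq_le w0 leNgt andbT; apply/negP => wj.
    by apply: (h j).
  exists i; rewrite Ex (bigD1 i) //= big1 => [|j /wz ->]; last by rewrite scale0r.
  have -> : w i = 1 by rewrite -w1 (bigD1 i) //= big1 ?addr0.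
  by rewrite scale1r addr0.
pose d := Num.min (w i) (w j).
have d0 : 0 < d by rewrite lt_min wi.
pose s (t : R) l : R := w l + t * (l == i)%:R - t * (l == j)%:R.
have s1 t : \sum_l s t l = 1.
  rewrite !big_split /= w1 sumrN -!mulr_sumr.
  have e1 (k : 'I_n) : \sum_l (l == k)%:R = 1 :> R.
    by rewrite (bigD1 k) //= eqxx big1 ?addr0 // => l /negPf ->.
  by rewrite !e1 addrK.
have sE t : \sum_l s t l *: p l = x + t *: (p i - p j).
  under eq_bigr do rewrite /s scalerBl scalerDl -!scalerA.
  rewrite !big_split /= sumrN -!scaler_sumr -Ex scalerBr addrA.
  have ep (k : 'I_n) : \sum_l (l == k)%:R *: p l = p k.
    rewrite (bigD1 k) //= eqxx scale1r big1 ?addr0 // => l /negPf ->.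
    by rewrite scale0r.
  by rewrite !ep.
have hs t : `|t| <= d -> conv_hull p (x + t *: (p i - p j)).
  move=> td; exists (s t); split=> // l; rewrite /s.
  move: td; rewrite le_min !ler_norml => /andP[/andP[? ?] /andP[? ?]].
  have := w0 l; case: (eqVneq l i) => [->|_]; case: (eqVneq _ j) => [->|_];
    rewrite ?mulr1 ?mulr0; lra.
have dd : `|d| <= d by rewrite ger0_norm // ltW.
have dd' : `|- d| <= d by rewrite normrN.
have /addrI E : x + d *: (p i - p j) = x + (- d) *: (p i - p j).
  apply: ex (hs _ dd) (hs _ dd') _; apply/sqdist_midpoint.
  by rewrite scaleNr addrACA subrr addr0.
move/eqP: E; rewrite scaleNr -addr_eq0 -mulr2n -scaler_nat scalerA scaler_eq0 mulf_eq0.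
by rewrite pnatr_eq0 (gt_eqF d0) /= subr_eq0 => /eqP/pinj ij; rewrite ij eqxx in ji.
Qed.

(** The sum of the determinants of the two sides at p i is an affine form that is
    0 at p i and positive at every other vertex. *)
Lemma vertex_extreme n (p : 'I_n -> R * R) i : convex_vertices p ->
  extreme (conv_hull p) (p i).
Proof.
move=> cp; have [n2 cp'] := cp.
pose k := ord_pred i; have kS : ordS k = i by rewrite ord_predK.
have [[l m] _ [n' g0 gp]] : exists2 lm : R * R, True & exists2 n' : R,
    aff lm.1 lm.2 n' (p i) = 0 & forall j, j != i -> 0 < aff lm.1 lm.2 n' (p j).
  pose g z := orient (p i) (p (ordS i)) z + orient (p k) (p i) z.
  exists ((p i).2 - (p (ordS i)).2 + ((p k).2 - (p i).2),
          (p (ordS i)).1 - (p i).1 + ((p i).1 - (p k).1)) => //=.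
  exists (g (0, 0)).
    by rewrite /aff /g /orient /=; ring.
  move=> j ji; rewrite (_ : aff _ _ _ _ = g (p j)); last first.
    by rewrite /aff /g /orient /=; ring.
  rewrite /g; have h1 := convex_side_ge0 i j cp; have h2 := convex_side_ge0 k j cp.
  rewrite kS in h2; case: (eqVneq j (ordS i)) => [jS|jS]; last first.
    by apply: ltr_pwDl => //; apply: cp'.
  apply: ltr_wpDl => //; rewrite -[X in orient _ (p X)]kS; apply: cp'; rewrite ?kS // jS.
  by rewrite -kS ordSS_neq.
split; first by have := @hull_comb3 _ _ p i i i 1 0 0; rewrite !scale0r scale1r !addr0;
  apply.
move=> y z hy hz /sqdist_midpoint yz.
have ge0 j : 0 <= aff l m n' (p j).
  by have [->|/gp/ltW//] := eqVneq j i; rewrite g0.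
have y0 := hull_ge0 ge0 hy; have z0 := hull_ge0 ge0 hz.
have yz0 : aff l m n' y + aff l m n' z = 0.
  have := congr1 fst yz; have := congr1 snd yz; rewrite !coordE => h2 h1.
  transitivity (aff l m n' (p i) + aff l m n' (p i)); last by rewrite g0 addr0.
  transitivity (l * (y.1 + z.1) + m * (y.2 + z.2) + n' + n').
    by rewrite /aff; ring.
  by rewrite h1 h2 /aff; ring.
have face x : conv_hull p x -> aff l m n' x <= 0 -> x = p i.
  by apply: hull_face1 gp; rewrite g0.
have -> : y = p i by apply: face hy _; lra.
by apply/esym; apply: face hz _; lra.
Qed.

(** Up to a factor 2 n, the moment of inertia of the vertices about their
    centroid. *)
Definition spread n (p : 'I_n -> R * R) : R := \sum_i \sum_j sqdist (p i) (p j).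

Lemma congruent_spread n (p q : 'I_n -> R * R) :
  convex_vertices p -> convex_vertices q ->
  congruent (conv_hull p) (conv_hull q) -> spread p = spread q.
Proof.
move=> cp cq [f [fd fpq]].
have fd' y z : sqdist (f y) (f z) = sqdist y z by apply: edist_sqdist.
have /choice[s sP] : forall i, exists j, f (p i) = q j.
  move=> i; apply: extreme_vertex; first exact: convex_vertices_inj.
  by rewrite -fpq; apply: extreme_isometry => //; apply: vertex_extreme.
have sinj : injective s.
  move=> i j E; apply: (convex_vertices_inj cp).
  have : sqdist (p i) (p j) = 0 by rewrite -fd' !sP E /sqdist !subrr expr0n addr0.
  move/eqP; rewrite /sqdist paddr_eq0 ?sqr_ge0 // !sqrf_eq0 !subr_eq0.
  by move=> /andP[/eqP h1 /eqP h2]; apply: eq_coord.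
rewrite /spread [RHS](reindex_inj sinj) /=; apply: eq_bigr => i _.
by rewrite [RHS](reindex_inj sinj) /=; apply: eq_bigr => j _; rewrite -!sP fd'.
Qed.

End Congruence.

(** * The one-parameter dissection of the model square *)

Section Dissection.
Context {R : realType}.
Implicit Types (u v : R) (k : 'I_4) (z : R * R).

Definition pA : R * R := (0, 0).
Definition pB : R * R := (2, 0).
Definition pC : R * R := (2, 2).
Definition pD : R * R := (0, 2).
(** The positions of M and N leave the areas of DAM and BCN below 1.  They are not
    symmetric about the centre of the square: if they were, DAMP and BCNQ would
    be congruent. *)
Definition pM : R * R := (1 / 4, 0).
Definition pN : R * R := (5 / 4, 2).
(** The line of the points P for which DAMP has area 1. *)
Definition pP u : R * R := (1 - u / 4, 2 * u).
(** The line of the points Q for which BCNQ has area 1. *)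
Definition pQ v : R * R := (1 + 3 * v / 4, 2 - 2 * v).

Definition corners : 'I_4 -> R * R := quad pA pB pC pD.

Definition piece u v k : 'I_4 -> R * R :=
  match val k with
  | 0%N => quad pD pA pM (pP u)
  | 1%N => quad pM pB (pQ v) (pP u)
  | 2%N => quad pB pC pN (pQ v)
  | _ => quad pN pD (pP u) (pQ v)
  end.

(** The equation says that MBQP has area 1; the bounds keep the pieces convex and
    their invariants apart. *)
Definition admissible u v :=
  [/\ 1 / 2 <= u <= 51 / 100, 2 / 3 <= v <= 7 / 10 & v * (2 - u) = 2 * u].

Definition companion u : R := 2 * u / (2 - u).

Lemma admissible_companion u : 1 / 2 <= u <= 51 / 100 -> admissible u (companion u).
Proof.
rewrite /companion => /andP[u1 u2]; split; first by rewrite u1.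
  have u0 : 0 < 2 - u by lra.
  by rewrite ler_pdivlMr // ler_pdivrMr //; apply/andP; split; lra.
by rewrite divfK //; apply/eqP; lra.
Qed.

Lemma corners_convex : convex_vertices corners.
Proof.
apply: (@fat_convex _ 4) => //; apply: fat_quad; rewrite /orient /=; lra.
Qed.

Lemma piece_fat u v k : admissible u v -> fat (1 / 5) (piece u v k).
Proof.
move=> [/andP[u1 u2] /andP[v1 v2] uv]; rewrite /piece.
by case: k => [[|[|[|[|//]]]] Hk]; apply: fat_quad; rewrite /orient /=; nra.
Qed.

Lemma piece_convex u v k : admissible u v -> convex_vertices (piece u v k).
Proof. by move=> /(@piece_fat _ _ k); apply: fat_convex; lra. Qed.

Lemma piece_shoelace u v k : admissible u v ->
  orient (piece u v k 0) (piece u v k 1) (piece u v k 2%:R) +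
  orient (piece u v k 2%:R) (piece u v k 3%:R) (piece u v k 0) = 2.
Proof.
move=> [_ _ uv]; rewrite /piece.
by case: k => [[|[|[|[|//]]]] Hk]; rewrite /orient /quad /=; lra.
Qed.

Lemma hull_quad_ge0 l m n (a b c d : R * R) z :
  0 <= aff l m n a -> 0 <= aff l m n b -> 0 <= aff l m n c -> 0 <= aff l m n d ->
  conv_hull (quad a b c d) z -> 0 <= aff l m n z.
Proof. by move=> ? ? ? ?; apply: hull_ge0; apply/forall_I4. Qed.

Lemma piece_box u v k z : admissible u v -> conv_hull (piece u v k) z ->
  (0 <= z.1 <= 2) /\ (0 <= z.2 <= 2).
Proof.
move=> [/andP[u1 u2] /andP[v1 v2] uv] hz.
have bnd l m n : (forall a, a \in [:: pA; pB; pC; pD; pM; pN; pP u; pQ v] ->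
    0 <= aff l m n a) -> 0 <= aff l m n z.
  move=> h; move: hz; rewrite /piece.
  by case: k => [[|[|[|[|//]]]] Hk] /=; apply: hull_quad_ge0; apply: h;
    rewrite !inE eqxx ?orbT.
have h1 : 0 <= aff 1 0 0 z.
  by apply: bnd => a; rewrite !inE; do 7?[case/orP];
    move=> /eqP ->; rewrite /aff /=; lra.
have h2 : 0 <= aff 0 1 0 z.
  by apply: bnd => a; rewrite !inE; do 7?[case/orP];
    move=> /eqP ->; rewrite /aff /=; lra.
have h3 : 0 <= aff (- 1) 0 2 z.
  by apply: bnd => a; rewrite !inE; do 7?[case/orP];
    move=> /eqP ->; rewrite /aff /=; lra.
have h4 : 0 <= aff 0 (- 1) 2 z.
  by apply: bnd => a; rewrite !inE; do 7?[case/orP];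
    move=> /eqP ->; rewrite /aff /=; lra.
by rewrite /aff in h1 h2 h3 h4; split; apply/andP; split; lra.
Qed.

(** The rays from c towards a, b, d positively span the plane: some positive
    combination of the three directions vanishes, so that the determinants against
    any vector cz cannot all have the same sign. *)
Lemma rays_cover (a b d c z : R * R) :
  0 < orient c a b -> 0 < orient c b d -> 0 < orient c d a ->
  ~ [/\ 0 < orient c a z, 0 < orient c b z & 0 <= orient c d z] /\
  ~ [/\ orient c a z < 0, orient c b z < 0 & orient c d z <= 0].
Proof.
move=> ab bd da.
have : orient c b d * orient c a z + orient c d a * orient c b z
       + orient c a b * orient c d z = 0 by rewrite /orient; ring.
by split=> -[? ? ?]; nra.
Qed.

(** A point outside BCNQ and DAMP is on the wrong side of one of the segments at P
    and of one of the segments at Q; according to its side of the line PQ it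
    belongs to NDPQ or to MBQP, for otherwise it would be on the same side of all
    three segments that issue from P, or from Q. *)
Lemma piece_cover u v z : admissible u v ->
  0 <= z.1 <= 2 -> 0 <= z.2 <= 2 -> exists k, conv_hull (piece u v k) z.
Proof.
move=> uv z1 z2.
have [h0 h1 h2 h3] : [/\ convex_vertices (quad pD pA pM (pP u)),
    convex_vertices (quad pM pB (pQ v) (pP u)),
    convex_vertices (quad pB pC pN (pQ v)) &
    convex_vertices (quad pN pD (pP u) (pQ v))].
  by split; [have := @piece_convex u v 0 uv|have := @piece_convex u v 1 uv
    |have := @piece_convex u v 2%:R uv|have := @piece_convex u v 3%:R uv].
have inpiece (a b c d : R * R) : convex_vertices (quad a b c d) ->
    0 <= orient a b z -> 0 <= orient b c z -> 0 <= orient c d z ->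
    0 <= orient d a z -> conv_hull (quad a b c d) z.
  move=> cq ? ? ? ?; rewrite hull_halfplanes //=.
  by apply/forall_I4; rewrite !ordS4.
have ex0 : 0 <= orient pM (pP u) z -> 0 <= orient (pP u) pD z ->
    conv_hull (piece u v 0) z.
  by move=> ? ?; apply: inpiece => //; rewrite /orient /=; lra.
have ex2 : 0 <= orient pN (pQ v) z -> 0 <= orient (pQ v) pB z ->
    conv_hull (piece u v 2%:R) z.
  by move=> ? ?; apply: inpiece => //; rewrite /orient /=; lra.
have ex1 : 0 <= orient pB (pQ v) z -> 0 <= orient (pQ v) (pP u) z ->
    0 <= orient (pP u) pM z -> conv_hull (piece u v 1) z.
  by move=> ? ? ?; apply: inpiece => //; rewrite /orient /=; lra.
have ex3 : 0 <= orient pD (pP u) z -> 0 <= orient (pP u) (pQ v) z ->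
    0 <= orient (pQ v) pN z -> conv_hull (piece u v 3%:R) z.
  by move=> ? ? ?; apply: inpiece => //; rewrite /orient /=; lra.
have [P1 P2 P3] : [/\ 0 < orient (pP u) pD pM, 0 < orient (pP u) pM (pQ v) &
    0 < orient (pP u) (pQ v) pD].
  by case: uv => /andP[? ?] /andP[? ?] _; split; rewrite /orient /=; nra.
have [Q1 Q2 Q3] : [/\ 0 < orient (pQ v) pB pN, 0 < orient (pQ v) pN (pP u) &
    0 < orient (pQ v) (pP u) pB].
  by case: uv => /andP[? ?] /andP[? ?] _; split; rewrite /orient /=; nra.
have [nP nP'] := rays_cover z P1 P2 P3; have [nQ nQ'] := rays_cover z Q1 Q2 Q3.
rewrite (orient_swap (pP u) (pQ v)) in nQ nQ' ex1.
rewrite (orient_swap pM (pP u)) in nP nP' ex1.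
rewrite (orient_swap (pP u) pD) in ex3.
rewrite (orient_swap pN (pQ v)) in nQ nQ' ex3.
rewrite (orient_swap (pQ v) pB) in ex1.
(* only the signs of five determinants matter from here on *)
move: ex0 ex1 ex2 ex3 nP nP' nQ nQ'.
move: (orient pM _ _) (orient _ pD _) (orient pN _ _) (orient _ pB _)
  (orient (pP u) (pQ v) z) => e1 e2 f1 f2 g ex0 ex1 ex2 ex3 nP nP' nQ nQ'.
have [in0|n0] := pselect (0 <= e1 /\ 0 <= e2); first by exists 0; case: in0.
have [in2|n2] := pselect (0 <= f1 /\ 0 <= f2); first by exists 2%:R; case: in2.
have [g0|/ltW g0] := lerP 0 g.
  exists 3%:R; apply: ex3 => //; rewrite oppr_ge0 leNgt; apply/negP => h.
    have [h'|h'] := lerP 0 e1; first by apply: n0; rewrite h' ltW.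
    by apply: nP; rewrite h oppr_gt0 h' g0.
  have [h'|h'] := lerP 0 f2; first by apply: n2; rewrite h' ltW.
  by apply: nQ'; rewrite h' oppr_lt0 h oppr_le0 g0.
exists 1; apply: ex1; rewrite ?oppr_ge0 // leNgt; apply/negP => h.
  have [h'|h'] := lerP 0 f1; first by apply: n2; rewrite h' ltW.
  by apply: nQ; rewrite h oppr_gt0 h' oppr_ge0 g0.
have [h'|h'] := lerP 0 e2; first by apply: n0; rewrite h' ltW.
by apply: nP'; rewrite h' oppr_lt0 h g0.
Qed.

(** * Traces of the pieces on the sides of the model square *)

Lemma piece_left u v k z : admissible u v -> k != 0 ->
  conv_hull (piece u v k) z -> z.1 <= 0 -> z = pD.
Proof.
move=> [/andP[u1 u2] /andP[v1 v2] _] k0 hz z0; move: hz k0; rewrite /piece.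
have le0 : aff 1 0 0 z <= 0 by rewrite /aff; lra.
have out (p : 'I_4 -> R * R) : (forall i, 0 < aff 1 0 0 (p i)) ->
    conv_hull p z -> z = pD.
  by move=> /hull_gt0 gt0 /gt0; rewrite ltNge le0.
case: k => [[|[|[|[|//]]]] Hk] //= hz _.
- by apply: out hz; apply/forall_I4; rewrite /quad /aff /=; split; lra.
- by apply: out hz; apply/forall_I4; rewrite /quad /aff /=; split; lra.
- apply: (hull_face1 (i0 := 1)) hz le0; first by rewrite /aff /quad /=; lra.
  by apply/forall_I4; rewrite /quad /aff /=; split=> // _; lra.
Qed.

Lemma piece_right u v k z : admissible u v -> k != 2%:R ->
  conv_hull (piece u v k) z -> 2 <= z.1 -> z = pB.
Proof.
move=> [/andP[u1 u2] /andP[v1 v2] _] k0 hz z0; move: hz k0; rewrite /piece.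
have le0 : aff (- 1) 0 2 z <= 0 by rewrite /aff; lra.
have out (p : 'I_4 -> R * R) : (forall i, 0 < aff (- 1) 0 2 (p i)) ->
    conv_hull p z -> z = pB.
  by move=> /hull_gt0 gt0 /gt0; rewrite ltNge le0.
case: k => [[|[|[|[|//]]]] Hk] //= hz _.
- by apply: out hz; apply/forall_I4; rewrite /quad /aff /=; split; lra.
- apply: (hull_face1 (i0 := 1)) hz le0; first by rewrite /aff /quad /=; lra.
  by apply/forall_I4; rewrite /quad /aff /=; split=> // _; lra.
- by apply: out hz; apply/forall_I4; rewrite /quad /aff /=; split; lra.
Qed.

Definition on_top k (t : R) : Prop :=
  match val k with
  | 0%N => t = 0
  | 1%N => False
  | 2%N => 5 / 4 <= t
  | _ => t <= 5 / 4
  end.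

Definition on_bottom k (t : R) : Prop :=
  match val k with
  | 0%N => t <= 1 / 4
  | 1%N => 1 / 4 <= t
  | 2%N => t = 2
  | _ => False
  end.

(** In the last case Q has a larger abscissa than N; the separating form for the
    conclusion is tilted by 1 / 4 to leave Q on the side of D. *)
Lemma piece_top u v k z :
  admissible u v -> conv_hull (piece u v k) z -> 2 <= z.2 -> on_top k z.1.
Proof.
move=> [/andP[u1 u2] /andP[v1 v2] _] hz z0; move: hz; rewrite /on_top /piece.
have le0 : aff 0 (- 1) 2 z <= 0 by rewrite /aff; lra.
case: k => [[|[|[|[|//]]]] Hk] /= hz.
- rewrite (hull_face1 (i0 := 0) _ _ hz le0) //; first by rewrite /aff /quad /=; lra.
  by apply/forall_I4; rewrite /quad /aff /=; split=> // _; lra.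
- have : 0 < aff 0 (- 1) 2 z; last by rewrite ltNge le0.
  by apply: hull_gt0 hz; apply/forall_I4; rewrite /quad /aff /=; split; lra.
- have : 0 <= aff 1 0 (- (5 / 4)) z.
    by apply: hull_quad_ge0 hz; rewrite /aff /=; lra.
  by rewrite /aff; lra.
- have : 0 <= aff (- 1) (- (1 / 4)) (7 / 4) z.
    by apply: hull_quad_ge0 hz; rewrite /aff /=; lra.
  by rewrite /aff; lra.
Qed.

(** In the first case P has a larger abscissa than M, whence a tilted form. *)
Lemma piece_bottom u v k z :
  admissible u v -> conv_hull (piece u v k) z -> z.2 <= 0 -> on_bottom k z.1.
Proof.
move=> [/andP[u1 u2] /andP[v1 v2] _] hz z0; move: hz; rewrite /on_bottom /piece.
have le0 : aff 0 1 0 z <= 0 by rewrite /aff; lra.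
case: k => [[|[|[|[|//]]]] Hk] /= hz.
- have : 0 <= aff (- 1) 1 (1 / 4) z.
    by apply: hull_quad_ge0 hz; rewrite /aff /=; lra.
  by rewrite /aff; lra.
- have : 0 <= aff 1 0 (- (1 / 4)) z.
    by apply: hull_quad_ge0 hz; rewrite /aff /=; lra.
  by rewrite /aff; lra.
- rewrite (hull_face1 (i0 := 0) _ _ hz le0) //; first by rewrite /aff /quad /=; lra.
  by apply/forall_I4; rewrite /quad /aff /=; split=> // _; lra.
- have : 0 < aff 0 1 0 z; last by rewrite ltNge le0.
  by apply: hull_gt0 hz; apply/forall_I4; rewrite /quad /aff /=; split; lra.
Qed.

(** * Spreads of the pieces *)

Lemma spread_quad (a b c d : R * R) : spread (quad a b c d) =
  2 * (sqdist a b + sqdist a c + sqdist a d + sqdist b c + sqdist b d + sqdist c d).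
Proof.
rewrite /spread !big_ord_recl !big_ord0 /= /sqdist; ring.
Qed.

(** At u = 1 / 2 the values are about 26.1, 19.8, 27.4 and 21.7. *)
Lemma spread_piece_range u v k : admissible u v ->
  match val k return Prop with
  | 0%N => 26 <= spread (piece u v k) <= 265 / 10
  | 1%N => spread (piece u v k) <= 205 / 10
  | 2%N => 27 <= spread (piece u v k)
  | _ => 21 <= spread (piece u v k) <= 25
  end.
Proof.
move=> [/andP[u1 u2] /andP[v1 v2] _]; rewrite /piece.
case: k => [[|[|[|[|//]]]] Hk] /=; rewrite spread_quad /sqdist /=.
- by apply/andP; split; nra.
- by nra.
- by nra.
- by apply/andP; split; nra.
Qed.

(** The spreads of MBQP and NDPQ increase with one of u, v and decrease with
    the other, so monotonicity also needs a comparison of the two increments; v is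
    a function of u whose derivative 4 / (2 - u) ^ 2 lies between 1 and 2. *)
Lemma spread_piece_lt u v u' v' k : admissible u v -> admissible u' v' -> u < u' ->
  spread (piece u v k) < spread (piece u' v' k).
Proof.
move=> [/andP[u1 u2] /andP[v1 v2] uv] [/andP[u1' u2'] /andP[v1' v2'] uv'] lt.
have [e [e0 eE]] : exists e, 0 < e /\ u' = u + e by exists (u' - u); lra.
have [f fE] : exists f, v' = v + f by exists (v' - v); lra.
have [f1 f2] : e <= f /\ f <= 2 * e.
  have E : f * (2 - u') = (2 + v) * e by rewrite eE; rewrite fE eE in uv'; lra.
  by split; nra.
rewrite eE fE in u1' u2' v1' v2' *; rewrite /piece.
case: k => [[|[|[|[|//]]]] Hk] /=; rewrite !spread_quad /sqdist /=.
all: by nra.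
Qed.

End Dissection.

(** * Placing pieces in the plane *)

Section Placement.
Context {R : realType}.
Implicit Types (a c : R) (b : bool) (z : R * R).

(** A translation for b = false, a reflection in a horizontal line followed by a
    translation for b = true. *)
Definition place b a c z : R * R := (z.1 + a, c + (-1) ^+ b * z.2).

Definition unplace b a c z : R * R := (z.1 - a, (-1) ^+ b * (z.2 - c)).

Lemma placeK b a c : cancel (place b a c) (unplace b a c).
Proof.
move=> z; apply: eq_coord; rewrite /=; first by rewrite addrK.
by rewrite addrC addKr mulrA -expr2 sqrr_sign mul1r.
Qed.

Lemma unplaceK b a c : cancel (unplace b a c) (place b a c).
Proof.
move=> z; apply: eq_coord; rewrite /=; first by rewrite subrK.
by rewrite mulrA -expr2 sqrr_sign mul1r addrC subrK.
Qed.

(** The listing of the vertices is reversed after a reflection, so that it remains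
    counterclockwise. *)
Definition placed b a c n (p : 'I_n -> R * R) (l : 'I_n) : R * R :=
  place b a c (p (if b then rev_ord l else l)).

Lemma rev_ordS n (l : 'I_n) : ordS (rev_ord (ordS l)) = rev_ord l.
Proof.
apply: val_inj => /=; case: n l => [[]//|n] l; have := ltn_ord l.
rewrite leq_eqVlt => /orP[/eqP ->|lt]; first by rewrite modnn subn1 /= modnn subnn.
rewrite (modn_small lt) subSS subSn; last by rewrite -ltnS.
rewrite modn_small // -subSn; last by rewrite -ltnS.
by rewrite subSS ltnS leq_subr.
Qed.

Lemma hull_rev n (p : 'I_n -> R * R) :
  conv_hull (fun l => p (rev_ord l)) = conv_hull p.
Proof.
have sub (q : 'I_n -> R * R) : conv_hull (fun l => q (rev_ord l)) `<=` conv_hull q.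
  move=> z [w [w0 w1 ->]]; exists (fun l => w (rev_ord l)); split=> //.
    by rewrite -w1 [RHS](reindex_inj rev_ord_inj).
  by rewrite [RHS](reindex_inj rev_ord_inj); under [RHS]eq_bigr do rewrite rev_ordK.
apply/seteqP; split; first exact: sub.
have := sub (fun l => p (rev_ord l)).
by under [X in conv_hull X `<=` _]funext do rewrite rev_ordK.
Qed.

Lemma place_comb b a c n (w : 'I_n -> R) (p : 'I_n -> R * R) : \sum_i w i = 1 ->
  \sum_i w i *: place b a c (p i) = place b a c (\sum_i w i *: p i).
Proof.
move=> w1; apply: eq_coord; rewrite /place /= ?fst_comb ?snd_comb /=.
  under eq_bigr do rewrite mulrDr.
  by rewrite big_split /= -mulr_suml w1 mul1r.
under eq_bigr do rewrite mulrDr mulrCA.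
by rewrite big_split /= -mulr_suml w1 mul1r -mulr_sumr.
Qed.

Lemma hull_placed b a c n (p : 'I_n -> R * R) z :
  conv_hull (placed b a c p) z <-> conv_hull p (unplace b a c z).
Proof.
have -> : conv_hull p = conv_hull (fun l => p (if b then rev_ord l else l)).
  by case: b; rewrite ?hull_rev.
split=> [[w [w0 w1 ->]]|[w [w0 w1 E]]]; exists w; split=> //.
  by rewrite /placed place_comb // placeK.
by rewrite /placed place_comb // -E unplaceK.
Qed.

Lemma orient_place b a c x y z :
  orient (place b a c x) (place b a c y) (place b a c z) = (-1) ^+ b * orient x y z.
Proof. by rewrite /orient /place /=; ring. Qed.

(** Every side of the placed polygon is a side of p, with its two ends exchanged
    when b holds; exchanging the ends and reflecting both change the sign of
    the determinant. *)
Lemma orient_placed b a c n (p : 'I_n -> R * R) i j : exists i' j',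
  [/\ (j == i) = (if b then j' == ordS i' else j' == i'),
      (j == ordS i) = (if b then j' == i' else j' == ordS i') &
      orient (placed b a c p i) (placed b a c p (ordS i)) (placed b a c p j) =
      orient (p i') (p (ordS i')) (p j')].
Proof.
rewrite /placed; case: b; last first.
  by exists i, j; split=> //; rewrite orient_place mul1r.
exists (rev_ord (ordS i)), (rev_ord j); rewrite rev_ordS !(inj_eq rev_ord_inj).
by split=> //; rewrite orient_place mulN1r -orient_swap.
Qed.

Lemma convex_placed b a c n (p : 'I_n -> R * R) :
  convex_vertices p -> convex_vertices (placed b a c p).
Proof.
move=> [n2 cp]; split=> // i j.
have [i' [j' [-> -> ->]]] := orient_placed b a c p i j.
by case: b => h1 h2; apply: cp.
Qed.

Lemma fat_placed b a c e p : fat e p -> fat e (placed b a c p).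
Proof.
move=> fp i j; have [i' [j' [-> -> ->]]] := orient_placed b a c p i j.
by case: b => h1 h2; apply: fp.
Qed.

Lemma area_placed b a c (p : 'I_4 -> R * R) : convex_vertices p ->
  area (conv_hull (placed b a c p)) = area (conv_hull p).
Proof.
move=> cp; rewrite !area_hull //; last exact: convex_placed.
congr (_ / 2)%:E; rewrite /placed !orient_place; case: b; last by rewrite !mul1r.
have -> : rev_ord 0 = 3%:R :> 'I_4 by apply: val_inj.
have -> : rev_ord 1 = 2%:R :> 'I_4 by apply: val_inj.
have -> : rev_ord 2%:R = 1 :> 'I_4 by apply: val_inj.
have -> : rev_ord 3%:R = 0 :> 'I_4 by apply: val_inj.
by rewrite /orient; ring.
Qed.

Lemma spread_placed b a c n (p : 'I_n -> R * R) : spread (placed b a c p) = spread p.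
Proof.
have E x y : sqdist (place b a c x) (place b a c y) = sqdist x y.
  by rewrite /sqdist /place /=; case: b; rewrite ?expr0 ?expr1; ring.
rewrite /spread /placed; case: b E => E; last first.
  by apply: eq_bigr => i _; apply: eq_bigr => j _.
rewrite [RHS](reindex_inj rev_ord_inj); apply: eq_bigr => i _.
by rewrite [RHS](reindex_inj rev_ord_inj); apply: eq_bigr => j _.
Qed.

(** The common ground of disjointness of interiors and of the vertex-to-vertex
    property. *)
Definition meets m n (p : 'I_m -> R * R) (q : 'I_n -> R * R) :=
  share_side p q \/ exists w, conv_hull p `&` conv_hull q `<=` [set w].

Lemma meetsC m n (p : 'I_m -> R * R) (q : 'I_n -> R * R) : meets p q -> meets q p.
Proof.
by case=> [/share_sideC|[w]]; [left|right; exists w; rewrite setIC].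
Qed.

Lemma share_side_placed b a c m n (p : 'I_m -> R * R) (q : 'I_n -> R * R) :
  share_side p q -> share_side (placed b a c p) (placed b a c q).
Proof.
move=> [i [j [h1 h2]]]; rewrite /placed; case: b; last first.
  by exists i, j; rewrite h1 h2.
by exists (rev_ord (ordS i)), (rev_ord (ordS j)); rewrite !rev_ordS !rev_ordK h1 h2.
Qed.

Lemma meets_placed b a c m n (p : 'I_m -> R * R) (q : 'I_n -> R * R) :
  meets p q -> meets (placed b a c p) (placed b a c q).
Proof.
case=> [/share_side_placed|[w wP]]; [by left|right].
exists (place b a c w) => z [/hull_placed hp /hull_placed hq].
by rewrite /= -(wP _ (conj hp hq)) unplaceK.
Qed.

Lemma meets_interiors m n (p : 'I_m -> R * R) (q : 'I_n -> R * R) :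
  convex_vertices p -> convex_vertices q -> meets p q ->
  (conv_hull p)° `&` (conv_hull q)° = set0.
Proof.
move=> cp cq [|[w wP]]; first exact: share_side_interiors.
(* a set with at most one point lies on both sides of a vertical line *)
rewrite -interiorI -[LHS]setIid.
apply: (@separated_interiors _ 1 0 (- w.1)); first by rewrite oner_eq0.
all: by move=> z /wP ->; rewrite /aff; lra.
Qed.

Lemma meets_vertex_to_vertex m n (p : 'I_m -> R * R) (q : 'I_n -> R * R) :
  convex_vertices p -> convex_vertices q -> meets p q ->
  let T := conv_hull p in let U := conv_hull q in
  [\/ is_edge (T `&` U) T /\ is_edge (T `&` U) U,
      exists x, T `&` U = [set x] | T `&` U = set0].
Proof.
move=> cp cq [s|[w wP]] /=; first by apply: Or31; apply: share_side_inter.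
have [E|/set0P[x px]] := eqVneq (conv_hull p `&` conv_hull q) set0.
  exact: Or33.
apply: Or32; exists w; apply/seteqP; split=> // _ ->.
by rewrite -(wP _ px).
Qed.

End Placement.

(** * The tiles *)

Section Tiles.
Context {R : realType}.
Implicit Types (i j : int) (k : 'I_4) (z : R * R).

(** The parameter u of the square (i, j): any injective choice in the admissible
    range would do. *)
Definition shape i j : R := 1 / 2 + 1 / (100 * (choice.pickle (i, j)).+1%:R).

Definition odd_row j := odd `|j|%N.

(** The ordinate to which row j sends the bottom side of the model square: the
    bottom of an even row, the top of a reflected one. *)
Definition axis j : R := if odd_row j then 2 * j%:~R + 2 else 2 * j%:~R.

Definition tile_vertices i j k : 'I_4 -> R * R :=
  placed (odd_row j) (2 * i%:~R) (axis j)
    (piece (shape i j) (companion (shape i j)) k).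

Definition tile i j k := conv_hull (tile_vertices i j k).

Lemma shape_admissible i j : admissible (shape i j) (companion (shape i j)).
Proof.
apply: admissible_companion; rewrite /shape; set n : R := (choice.pickle (i, j)).+1%:R.
have n1 : 1 <= n by rewrite ler1n.
have n0 : 0 < 100 * n by lra.
have : 0 < 1 / (100 * n) <= 1 / 100.
  apply/andP; split; first by rewrite divr_gt0.
  by rewrite ler_pdivrMr //; lra.
by move: (1 / (100 * n)) => t /andP[? ?]; apply/andP; split; lra.
Qed.

Lemma shape_inj i j i' j' : shape i j = shape i' j' -> (i, j) = (i', j').
Proof.
move/addrI; rewrite !div1r => /invr_inj; have h : (100 : R) != 0 by rewrite pnatr_eq0.
move/(mulfI h)/eqP; rewrite eqr_nat eqSS => /eqP E.
exact: (pcan_inj choice.pickleK E).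
Qed.

Lemma tile_convex i j k : convex_vertices (tile_vertices i j k).
Proof. by apply: convex_placed; apply: piece_convex; apply: shape_admissible. Qed.

Lemma odd_rowS j : odd_row (j + 1) = ~~ odd_row j.
Proof.
rewrite /odd_row; case: j => [n|n]; first by rewrite -PoszD addn1.
by case: n => [|n] //=; rewrite subn1 negbK.
Qed.

Lemma axisS j : axis (j + 1) = if odd_row j then axis j else axis j + 4.
Proof. by rewrite /axis odd_rowS intrD; case: (odd_row j) => /=; lra. Qed.

Lemma tileP i j k z : tile i j k z <->
  conv_hull (piece (shape i j) (companion (shape i j)) k)
    (unplace (odd_row j) (2 * i%:~R) (axis j) z).
Proof. exact: hull_placed. Qed.

Lemma tile_box i j k z : tile i j k z ->
  (2 * i%:~R <= z.1 <= 2 * i%:~R + 2) /\ (2 * j%:~R <= z.2 <= 2 * j%:~R + 2).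
Proof.
move=> /tileP /(piece_box (shape_admissible i j)) [].
rewrite /unplace /axis /=; case: (odd_row j); rewrite ?expr0 ?expr1.
all: by move=> /andP[? ?] /andP[? ?]; split; apply/andP; split; lra.
Qed.

Lemma tile_cover i j z :
  2 * i%:~R <= z.1 <= 2 * i%:~R + 2 -> 2 * j%:~R <= z.2 <= 2 * j%:~R + 2 ->
  exists k, tile i j k z.
Proof.
move=> z1 z2.
have [||k hk] := @piece_cover _ _ _ (unplace (odd_row j) (2 * i%:~R) (axis j) z)
  (shape_admissible i j).
- by move: z1 => /andP[? ?]; rewrite /unplace /=; apply/andP; split; lra.
- move: z2 => /andP[? ?]; rewrite /unplace /axis /=.
  by case: (odd_row j); rewrite ?expr0 ?expr1; apply/andP; split; lra.
- by exists k; apply/tileP.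
Qed.

Lemma int_lt_step i i' : i < i' -> i%:~R + 1 <= i'%:~R :> R.
Proof. by rewrite -lezD1 -(ler_int R) intrD. Qed.

(** * Any two tiles meet in a common side or in at most one point *)

Lemma pieces_meet u v k k' : admissible u v -> k != k' ->
  meets (piece u v k) (piece u v k' : _ -> R * R).
Proof.
move=> uv; wlog : k k' / (k < k')%N => [th kk'|].
  have [lt|gt|E] := ltngtP k k'; first exact: th.
    by apply: meetsC; apply: th => //; rewrite eq_sym.
  by rewrite (val_inj E) eqxx in kk'.
have share (p q : 'I_4 -> R * R) (l l' : 'I_4) :
  p l = q (ordS l') -> p (ordS l) = q l' -> meets p q by left; exists l, l'.
case: k k' => [[|[|[|[|//]]]] Hk] [[|[|[|[|//]]]] Hk'] //= _ _.
- by apply: (share _ _ 2%:R 3%:R).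
(* DAMP and BCNQ are disjoint: the vertical line of abscissa 1 separates them *)
- right; exists 0 => z [h0 h2].
  case: uv => /andP[u1 u2] /andP[v1 v2] _.
  have : 0 < aff (- 1) 0 1 z.
    by apply: hull_gt0 h0; apply/forall_I4; rewrite /aff /quad /=; split; lra.
  have : 0 < aff 1 0 (- 1) z.
    by apply: hull_gt0 h2; apply/forall_I4; rewrite /aff /quad /=; split; lra.
  by rewrite /aff => *; exfalso; lra.
- by apply: (share _ _ 3%:R 1).
- by apply: (share _ _ 1 3%:R).
- by apply: (share _ _ 2%:R 2%:R).
- by apply: (share _ _ 2%:R 3%:R).
Qed.

(** Only BCNQ has more than one point on the right side of its square, and only
    DAMP on the left side; they share a side exactly when their squares lie in
    the same row. *)
Lemma tiles_meet_right i j j' k k' :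
  meets (tile_vertices i j k) (tile_vertices (i + 1) j' k').
Proof.
have line z : tile i j k z -> tile (i + 1) j' k' z -> z.1 = 2 * i%:~R + 2.
  move=> /tile_box[/andP[? ?] _] /tile_box[+ _]; rewrite intrD => /andP[? ?].
  by lra.
have [k2|k2] := eqVneq k 2%:R; last first.
  right; exists (place (odd_row j) (2 * i%:~R) (axis j) pB) => z [hz hz'].
  have z1 := line _ hz hz'; move/tileP: hz.
  move/(piece_right (shape_admissible i j) k2) => <-; first by rewrite /= unplaceK.
  by rewrite /unplace /=; lra.
have [k0|k0] := eqVneq k' 0; last first.
  right; exists (place (odd_row j') (2 * (i + 1)%:~R) (axis j') pD) => z [hz hz'].
  have z1 := line _ hz hz'; move/tileP: hz'.
  move/(piece_left (shape_admissible _ _) k0) => <-; first by rewrite /= unplaceK.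
  by rewrite /unplace /= intrD; lra.
have [jj'|jj'|<-] := ltgtP j j'.
- right; exists (2 * i%:~R + 2, 2 * j%:~R + 2) => z [hz hz'].
  apply: eq_coord; first exact: line hz'.
  move: hz hz' (int_lt_step jj') => /tile_box[_ /andP[? ?]] /tile_box[_ /andP[? ?]].
  by move=> ? /=; lra.
- right; exists (2 * i%:~R + 2, 2 * j%:~R) => z [hz hz'].
  apply: eq_coord; first exact: line hz'.
  move: hz hz' (int_lt_step jj') => /tile_box[_ /andP[? ?]] /tile_box[_ /andP[? ?]].
  by move=> ? /=; lra.
rewrite /tile_vertices k2 k0; left.
have -> n (p : 'I_n -> R * R) : placed (odd_row j) (2 * (i + 1)%:~R) (axis j) p =
    placed (odd_row j) (2 * i%:~R) (axis j) (fun l => ((p l).1 + 2, (p l).2)).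
  apply/funext => l; rewrite /placed /place /= intrD; congr pair; lra.
apply: share_side_placed; exists 0, 0.
by rewrite !ordS4 /piece /quad /=; split; apply: eq_coord => /=; lra.
Qed.

(** The two squares are reflections of each other in their common side, so that
    a common point comes from a single point of the model square, on its top side
    if j is even and on its bottom side if j is odd.  The traces of the pieces on
    that side then show that the tiles share the side if they are copies of the
    same piece with a side there, and have at most one common point otherwise. *)
Lemma tiles_meet_up i j k k' :
  meets (tile_vertices i j k) (tile_vertices i (j + 1) k').
Proof.
have line z : tile i j k z -> tile i (j + 1) k' z -> z.2 = 2 * j%:~R + 2.
  move=> /tile_box[_ /andP[? ?]] /tile_box[_ +]; rewrite intrD => /andP[? ?].
  by lra.
pose e : R := if odd_row j then 0 else 2.
have pull z : tile i j k z -> tile i (j + 1) k' z ->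
    conv_hull (piece (shape i j) (companion (shape i j)) k)
      (z.1 - 2 * i%:~R, e) /\
    conv_hull (piece (shape i (j + 1)) (companion (shape i (j + 1))) k')
      (z.1 - 2 * i%:~R, e).
  move=> hz hz'; have z2 := line _ hz hz'.
  move/tileP: hz; move/tileP: hz'; rewrite odd_rowS axisS.
  have -> : unplace (odd_row j) (2 * i%:~R) (axis j) z = (z.1 - 2 * i%:~R, e).
    by apply: eq_coord => //=; rewrite /e /axis z2;
      case: (odd_row j); rewrite ?expr0 ?expr1; lra.
  set u := unplace _ _ _ _; have -> // : u = (z.1 - 2 * i%:~R, e).
  by apply: eq_coord => //=; rewrite /e /axis z2;
    case: (odd_row j); rewrite ?expr0 ?expr1 /=; lra.
have at_most (x : R) : (forall z, tile i j k z -> tile i (j + 1) k' z ->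
    z.1 = 2 * i%:~R + x) -> meets (tile_vertices i j k) (tile_vertices i (j + 1) k').
  move=> h; right; exists (2 * i%:~R + x, 2 * j%:~R + 2) => z [hz hz'].
  by apply: eq_coord; [apply: h hz hz'|apply: line hz hz'].
have at_most_top (x : R) : odd_row j = false -> (forall t : R,
    on_top k t -> on_top k' t -> t = x) ->
    meets (tile_vertices i j k) (tile_vertices i (j + 1) k').
  move=> oj h; apply: (at_most x) => z hz hz'.
  have [] := pull _ hz hz'; rewrite /e oj => p1 p2.
  have := h _ (piece_top (shape_admissible _ _) p1 (lexx _))
              (piece_top (shape_admissible _ _) p2 (lexx _)).
  by move=> /= <-; rewrite addrC subrK.
have at_most_bottom (x : R) : odd_row j -> (forall t : R,
    on_bottom k t -> on_bottom k' t -> t = x) ->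
    meets (tile_vertices i j k) (tile_vertices i (j + 1) k').
  move=> oj h; apply: (at_most x) => z hz hz'.
  have [] := pull _ hz hz'; rewrite /e oj => p1 p2.
  have := h _ (piece_bottom (shape_admissible _ _) p1 (lexx _))
              (piece_bottom (shape_admissible _ _) p2 (lexx _)).
  by move=> /= <-; rewrite addrC subrK.
have placed_up (p : 'I_4 -> R * R) :
    placed (~~ odd_row j) (2 * i%:~R) (axis (j + 1)) p =
    placed (odd_row j) (2 * i%:~R) (axis j)
      (placed true 0 (if odd_row j then 0 else 4) p).
  apply/funext => l; rewrite axisS /placed /place /=.
  by case: (odd_row j); rewrite ?rev_ordK; congr pair; rewrite /= ?expr0 ?expr1; lra.
have share (l l' : 'I_4) :
    let p := piece (shape i j) (companion (shape i j)) k in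
    let q := placed true 0 (if odd_row j then 0 else 4)
      (piece (shape i (j + 1)) (companion (shape i (j + 1))) k') in
    p l = q (ordS l') -> p (ordS l) = q l' ->
    meets (tile_vertices i j k) (tile_vertices i (j + 1) k').
  move=> p q h1 h2; rewrite /tile_vertices odd_rowS placed_up.
  by apply: meets_placed; left; exists l, l'.
case oj : (odd_row j) share at_most_top at_most_bottom => share top bottom.
- case: k k' share bottom {pull line at_most top} =>
    [[|[|[|[|//]]]] Hk] [[|[|[|[|//]]]] Hk'] share bottom;
    first [by apply: (bottom (1 / 4)) => // t; rewrite /on_bottom /= => t1 t2; lra
          |by apply: (bottom 2) => // t; rewrite /on_bottom /= => t1 t2; lra|idtac].
  + by apply: (share 1 1); rewrite /piece /quad /placed /place /=;
      apply: eq_coord => /=; rewrite ?expr1; lra.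
  + by apply: (share 0 2%:R); rewrite /piece /quad /placed /place /=;
      apply: eq_coord => /=; rewrite ?expr1; lra.
- case: k k' share top {pull line at_most bottom} =>
    [[|[|[|[|//]]]] Hk] [[|[|[|[|//]]]] Hk'] share top;
    first [by apply: (top 0) => // t; rewrite /on_top /= => t1 t2; lra
          |by apply: (top (5 / 4)) => // t; rewrite /on_top /= => t1 t2; lra|idtac].
  + by apply: (share 1 1); rewrite /piece /quad /placed /place /=;
      apply: eq_coord => /=; rewrite ?expr1; lra.
  + by apply: (share 0 2%:R); rewrite /piece /quad /placed /place /=;
      apply: eq_coord => /=; rewrite ?expr1; lra.
Qed.

Lemma tiles_meet i j k i' j' k' : (i, j, k) != (i', j', k') ->
  meets (tile_vertices i j k) (tile_vertices i' j' k').
Proof.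
have far_right i0 i1 j0 j1 k0 k1 : i0 < i1 ->
    meets (tile_vertices i0 j0 k0) (tile_vertices i1 j1 k1).
  move=> lt; have [<-|ne] := eqVneq (i0 + 1) i1; first exact: tiles_meet_right.
  right; exists 0 => z [/tile_box[/andP[? ?] _] /tile_box[/andP[? ?] _]].
  have : i0 + 1 < i1 by rewrite lt_neqAle ne lezD1.
  move/int_lt_step; rewrite intrD => ?.
  by suff : (0 : R) < 0; [rewrite ltxx|lra].
have far_up j0 j1 k0 k1 : j0 < j1 ->
    meets (tile_vertices i j0 k0) (tile_vertices i j1 k1).
  move=> lt; have [<-|ne] := eqVneq (j0 + 1) j1; first exact: tiles_meet_up.
  right; exists 0 => z [/tile_box[_ /andP[? ?]] /tile_box[_ /andP[? ?]]].
  have : j0 + 1 < j1 by rewrite lt_neqAle ne lezD1.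
  move/int_lt_step; rewrite intrD => ?.
  by suff : (0 : R) < 0; [rewrite ltxx|lra].
have [lt|gt|<-] := ltgtP i i'; first by move=> _; exact: far_right.
  by move=> _; apply: meetsC; apply: far_right.
have [lt|gt|<-] := ltgtP j j'; first by move=> _; exact: far_up.
  by move=> _; apply: meetsC; apply: far_up.
rewrite xpair_eqE eqxx /= => kk'.
by apply: meets_placed; apply: pieces_meet => //; apply: shape_admissible.
Qed.

(** * Congruence, area and size of the tiles *)

Lemma tile_spread_inj i j k i' j' k' :
  spread (tile_vertices i j k) = spread (tile_vertices i' j' k') ->
  (i, j, k) = (i', j', k').
Proof.
rewrite !spread_placed => E.
have a1 := shape_admissible i j; have a2 := shape_admissible i' j'.
have kk' : k = k'.
  have := spread_piece_range k a1; have := spread_piece_range k' a2.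
  rewrite -E; move: (spread _) => s {E}.
  case: k k' => [[|[|[|[|//]]]] Hk] [[|[|[|[|//]]]] Hk'] /= h h';
    try exact: val_inj; move: h h' => *; exfalso; lra.
rewrite -kk' in E *; congr (_, _); apply: shape_inj.
have [lt|gt|//] := ltgtP (shape i j) (shape i' j').
  by have := spread_piece_lt k a1 a2 lt; rewrite E ltxx.
by have := spread_piece_lt k a2 a1 gt; rewrite E ltxx.
Qed.

Lemma tile_noncongruent i j k i' j' k' : (i, j, k) != (i', j', k') ->
  ~ congruent (tile i j k) (tile i' j' k').
Proof.
move=> /eqP ne /congruent_spread E; apply: ne; apply: tile_spread_inj.
by apply: E; apply: tile_convex.
Qed.

Lemma area_tile i j k : area (tile i j k) = 1%:E.
Proof.
have adm := shape_admissible i j.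
rewrite area_placed; last exact: piece_convex.
by rewrite area_hull ?piece_shoelace ?divff //; exact: piece_convex.
Qed.

Lemma tile_normal i j k :
  (exists c, eball c (1 / 40) `<=` tile i j k) /\ (exists c, tile i j k `<=` eball c 2).
Proof.
split.
  exists (centroid (tile_vertices i j k)).
  have -> : 1 / 40 = (1 / 5) / (4 * 2) :> R by lra.
  apply: fat_ball; [lra|lra| |].
    by apply: fat_placed; apply: piece_fat; apply: shape_admissible.
  move=> l l'; have vert m : tile i j k (tile_vertices i j k m).
    have := @hull_comb3 _ _ (tile_vertices i j k) m m m 1 0 0.
    by rewrite !scale0r scale1r !addr0; apply.
  have [/andP[? ?] /andP[? ?]] := tile_box (vert l).
  have [/andP[? ?] /andP[? ?]] := tile_box (vert l').
  by rewrite !ler_norml; split; apply/andP; split; lra.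
exists (2 * i%:~R + 1, 2 * j%:~R + 1) => z /tile_box[/andP[? ?] /andP[? ?]].
rewrite -[2]mulr1; apply: coord_eball => //=.
  by rewrite ler_norml; apply/andP; split; lra.
by rewrite ler_norml; apply/andP; split; lra.
Qed.

(** * The squares *)

Definition cell i j : set (R * R) :=
  conv_hull (placed false (2 * i%:~R) (2 * j%:~R) corners).

Lemma cellP i j z : cell i j z <->
  (2 * i%:~R <= z.1 <= 2 * i%:~R + 2) /\ (2 * j%:~R <= z.2 <= 2 * j%:~R + 2).
Proof.
rewrite /cell hull_placed hull_halfplanes; last exact: corners_convex.
rewrite /= forall_I4 !ordS4 /corners /quad /orient /unplace /= expr0.
split=> [[? ? ? ?]|[/andP[? ?] /andP[? ?]]]; last by split; lra.
by split; apply/andP; split; lra.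
Qed.

Lemma cell_union i j : cell i j = \bigcup_k tile i j k.
Proof.
apply/seteqP; split=> [z /cellP[h1 h2]|z [k _ /tile_box h]]; last exact/cellP.
by have [k hk] := tile_cover h1 h2; exists k.
Qed.

Lemma square_cell i j : square (cell i j).
Proof.
exists (placed false (2 * i%:~R) (2 * j%:~R) corners); split=> //.
- by apply: convex_placed; apply: corners_convex.
- suff E l : Defs.edist (placed false (2 * i%:~R) (2 * j%:~R) corners l)
      (placed false (2 * i%:~R) (2 * j%:~R) corners (ordS l)) = Num.sqrt (4 : R).
    by move=> l l'; rewrite !E.
  move: l; apply/forall_I4; rewrite !ordS4.
  by split; rewrite edistE; congr Num.sqrt;
    rewrite /sqdist /placed /place /corners /quad /= expr0; ring.
- apply/forall_I4; rewrite !ordS4.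
  by split; rewrite /dot /placed /place /corners /quad /= expr0; ring.
Qed.

Lemma cells_interiors i j i' j' : (i, j) != (i', j') ->
  (cell i j)° `&` (cell i' j')° = set0.
Proof.
have right i0 i1 j0 j1 : i0 < i1 -> (cell i0 j0)° `&` (cell i1 j1)° = set0.
  move=> /int_lt_step h.
  apply: (@separated_interiors _ (- 1) 0 (2 * i0%:~R + 2)).
  - by rewrite oppr_eq0 oner_eq0.
  - by move=> z /cellP[/andP[? ?] _]; rewrite /aff; lra.
  - by move=> z /cellP[/andP[? ?] _]; rewrite /aff; lra.
have up j0 j1 : j0 < j1 -> (cell i j0)° `&` (cell i j1)° = set0.
  move=> /int_lt_step h.
  apply: (@separated_interiors _ 0 (- 1) (2 * j0%:~R + 2)).
  - by rewrite oppr_eq0 oner_eq0 orbT.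
  - by move=> z /cellP[_ /andP[? ?]]; rewrite /aff; lra.
  - by move=> z /cellP[_ /andP[? ?]]; rewrite /aff; lra.
have [lt|gt|<-] := ltgtP i i'; first by move=> _; apply: right.
  by move=> _; rewrite setIC; apply: right.
have [lt|gt|<-] := ltgtP j j'; first by move=> _; apply: up.
  by move=> _; rewrite setIC; apply: up.
by rewrite eqxx.
Qed.

Lemma cells_cover z : exists i j, cell i j z.
Proof.
exists (Num.floor (z.1 / 2)), (Num.floor (z.2 / 2)); apply/cellP.
have := floor_itv (z.1 / 2); have := floor_itv (z.2 / 2); rewrite !intrD.
by move=> /andP[? ?] /andP[? ?]; split; apply/andP; split; lra.
Qed.

End Tiles.

Theorem theorem3 (R : realType) :
  exists TT : set (set (R * R)),
    [/\ tiling TT, normal TT, vertex_to_vertex TT, pairwise_noncongruent TT &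
        forall T, TT T -> convex_quadrangle T /\ area T = 1%:E] /\
    exists SS : set (set (R * R)),
      [/\ tiling SS,
          forall S, SS S -> square S,
          forall S, SS S -> exists Q : 'I_4 -> set (R * R), dissected_into4 TT S Q &
          forall T, TT T ->
            exists S (Q : 'I_4 -> set (R * R)) (i : 'I_4),
              [/\ SS S, dissected_into4 TT S Q & T = Q i]].
Proof.
pose tileI (x : int * int * 'I_4) : set (R * R) := tile x.1.1 x.1.2 x.2.
pose cellI (x : int * int) : set (R * R) := cell x.1 x.2.
have dissect i j : dissected_into4 (range tileI) (cell i j) (tile i j).
  split; [by move=> k; exists (i, j, k)| |exact: cell_union].
  by move=> k k' kk'; apply: tile_noncongruent; rewrite xpair_eqE eqxx.
have distinct (x y : int * int * 'I_4) : tileI x <> tileI y -> x != y.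
  by move=> ne; apply: contra_notN ne => /eqP ->.
exists (range tileI); split; first split.
- split.
  + exact: sub_countable (card_image_le _ _) (countableP _).
  + by move=> _ [x _ <-]; apply: compact_hull; apply: tile_convex.
  + move=> _ _ [[[i j] k] _ <-] [[[i' j'] k'] _ <-] /distinct ne.
    by apply: meets_interiors; [exact: tile_convex|exact: tile_convex|exact: tiles_meet].
  + apply/seteqP; split=> // z _; have [i [j]] := cells_cover z.
    rewrite cell_union => -[k _ hz]; exists (tile i j k); last exact: hz.
    by exists (i, j, k).
- exists (1 / 40), 2; split; [lra|lra| |].
  + by move=> _ [[[i j] k] _ <-]; exact: (tile_normal i j k).1.
  + by move=> _ [[[i j] k] _ <-]; exact: (tile_normal i j k).2.
- move=> _ _ [[[i j] k] _ <-] [[[i' j'] k'] _ <-] /distinct ne.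
  by apply: meets_vertex_to_vertex;
    [exact: tile_convex|exact: tile_convex|exact: tiles_meet].
- move=> _ _ [[[i j] k] _ <-] [[[i' j'] k'] _ <-] /distinct.
  exact: tile_noncongruent.
- move=> _ [[[i j] k] _ <-]; split; last exact: area_tile.
  by exists (tile_vertices i j k); split=> //; apply: tile_convex.
exists (range cellI); split.
- split.
  + exact: sub_countable (card_image_le _ _) (countableP _).
  + move=> _ [x _ <-]; apply: compact_hull; apply: convex_placed.
    exact: corners_convex.
  + move=> _ _ [[i j] _ <-] [[i' j'] _ <-] ne; apply: cells_interiors.
    by apply: contra_notN ne => /eqP[-> ->].
  + apply/seteqP; split=> // z _; have [i [j hz]] := cells_cover z.
    by exists (cell i j); [exists (i, j)|exact: hz].
- by move=> _ [[i j] _ <-]; apply: square_cell.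
- by move=> _ [[i j] _ <-]; exists (tile i j); exact: dissect.
- move=> _ [[[i j] k] _ <-]; exists (cell i j), (tile i j), k; split.
  + by exists (i, j).
  + exact: dissect.
  + by [].
Qed.
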